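(* Let $G_\Gamma$ be a graph product of finite cyclic groups whose defining graph $\Gamma$ (a finite simplicial graph) has no SILs. Let $\tilde\Gamma$ and $X_{\tilde\Gamma}$ be as described in the context, and let $Aut^{pc}(G_\Gamma)$ act on $X_{\tilde\Gamma}$ via the isomorphism $\phi: G_{\tilde\Gamma}\to Aut^{pc}(G_\Gamma)$, $p_{v,C}\mapsto\pi_{v,C}$, and left multiplication of $G_{\tilde\Gamma}$ on cosets. Then this action of $Aut^{pc}(G_\Gamma)$ on $X_{\tilde\Gamma}$ extends to a faithful, geometric action of the semi-direct product $Aut^{pc}(G_\Gamma)\rtimes\Sigma_\Gamma$, the subgroup of $Aut(G_\Gamma)$ generated by partial conjugations, graph symmetries and vertex isomorphisms.
   Context: Graph product: for a finite simplicial graph $\Gamma$ with vertex set $V$ and groups $G_v$ ($v\in V$), $G_\Gamma$ is the quotient of the free product of the $G_v$ by the relations that $G_v$ and $G_w$ commute elementwise whenever $v,w$ are joined by an edge. When the $G_v$ are cyclic, $v$ also denotes a fixed generator of $G_v$, and $|v|$ is the order of $G_v$. For $T\subseteq V$, $G_T$ is the subgroup of $G_\Gamma$ generated by the $G_v$, $v\in T$; $G_\emptyset=\{1\}$. $lk(v)$ is the full subgraph spanned by the vertices adjacent to $v$; $st(v)$ is the full subgraph spanned by $v$ and $lk(v)$. For a subgraph $A$, $\Gamma\smallsetminus A$ is the full subgraph spanned by the vertices not in $A$. $d(v,w)=d_\Gamma(v,w)$ is the edge-path distance, equal to $\infty$ (so $\ge 2$) for vertices in different components. SIL: $\Gamma$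 has a separating intersection of links (SIL) if for some pair of vertices $v,w$ with $d_\Gamma(v,w)\ge 2$ there is a connected component of $\Gamma\smallsetminus(lk(v)\cap lk(w))$ containing neither $v$ nor $w$. Partial conjugation: for a vertex $v$ and a connected component $C$ of $\Gamma\smallsetminus st(v)$, $\pi_{v,C}\in Aut(G_\Gamma)$ sends each generator $x\in C$ to $vxv^{-1}$ and fixes every generator not in $C$. $Aut^{pc}(G_\Gamma)$ is the subgroup of $Aut(G_\Gamma)$ generated by all partial conjugations. $\Sigma_\Gamma$ is the finite subgroup of $Aut(G_\Gamma)$ generated by graph symmetries (automorphisms of $G_\Gamma$ induced by symmetries of $\Gamma$, which permute the generators $v$) and vertex isomorphisms (automorphisms of a single vertex group $G_v$, extended by fixing all other generators). The graph $\tilde\Gamma$: its vertices are symbols $p_{v,C}$, one for each pair $(v,C)$ with $v\in V$ and $C$ a connected component of $\Gamma\smallsetminus st(v)$. Two distinct vertices $p_{v,C}$ and $p_{w,D}$ are joined by an edge unless $d(v,w)\ge 2$, $v\in D$ and $w\in C$. The vertex $p_{v,C}$ is labelled by a cyclic group of order $|v|$ with generator also written $p_{v,C}$, and $G_{\tilde\Gamma}$ is the resulting graph product. When $\Gamma$ has no SIL, $p_{v,C}\mapsto\pi_{v,C}$ induces an isomorphism $\phi:G_{\tilde\Gamma}\to Aut^{pc}(G_\Gamma)$. The complex $X_\Lambda$ for a graph product $G_\Lambda$ of cyclic groups over a finite simplicial graph $\Lambda$: it is the geometric realization of the poset, ordered by inclusion, of all cosets $gG_T$ with $g\in G_\Lambda$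 and $T$ a (possibly empty) set of vertices spanning a complete subgraph of $\Lambda$. $G_\Lambda$ acts by left multiplication on cosets. $X_\Lambda$ is a cubical complex whose cubes are the translates by $g\in G_\Lambda$ of the intervals $[G_{T_1},G_{T_2}]$ ($T_1\subseteq T_2$), the subcomplexes spanned by the vertices $G_T$ with $T_1\subseteq T\subseteq T_2$, each combinatorially a cube of dimension $|T_2\smallsetminus T_1|$. It carries the path metric making each such cube a unit Euclidean cube; it is a right-angled building. An action is geometric if it is proper, cocompact and by isometries.
   Formalization: Vertex groups are taken nontrivial, and faithfulness is claimed only if at most one vertex v has st(v) = Γ and such a v has order 2; otherwise it fails (Γ a single vertex with group Z/3: X is a point, but Σ = Z/2). *)

(* Defs.v *)
From HB Require Import structures.
From Stdlib Require Import Relation_Operators.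
From mathcomp Require Import all_boot all_order all_algebra all_fingroup.
From mathcomp Require Import generic_quotient.
From mathcomp Require Import all_classical all_reals all_analysis.
Set Implicit Arguments.
Unset Strict Implicit.
Unset Printing Implicit Defensive.
Import Order.TTheory GRing.Theory Num.Theory.

Local Open Scope classical_set_scope.
Local Open Scope group_scope.

Section Groups.
Variable A : groupType.

Definition is_subgroup (H : set A) :=
  H 1 /\ forall x y, H x -> H y -> H (x * y^-1).

Definition subgroup_gen (S : set A) : set A := smallest is_subgroup S.

Definition left_coset (g : A) (S : set A) : set A := [set g * x | x in S].

Definition internal_sdprod (N K H : set A) :=
  [/\ is_subgroup N, is_subgroup K,
      (forall k n, K k -> N n -> N (k * n * k^-1)),
      N `&` K = [set 1] &
      H = [set n * k | n in N & k in K]].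

End Groups.

Record group_aut (G : groupType) := GroupAut {
  aut_fun :> G -> G;
  aut_inv : G -> G;
  autM : {morph aut_fun : x y / x * y};
  autK : cancel aut_fun aut_inv;
  autVK : cancel aut_inv aut_fun }.

Section AutGroup.
Variable G : groupType.
Implicit Types a b : group_aut G.

Lemma group_autP a b : (forall x, a x = b x) -> a = b.
Proof.
move: a b => [f f' fM fK f'K] [g g' gM gK g'K] /= /funext fg.
move: fM fK f'K gM gK g'K; rewrite fg => fM fK f'K gM gK g'K.
have f'g' : f' = g' by apply/funext => x; rewrite -{1}(g'K x) fK.
move: fK f'K; rewrite f'g' => fK f'K.
by congr GroupAut; exact: Prop_irrelevance.
Qed.

Lemma aut_invM a : {morph aut_inv a : x y / x * y}.
Proof. by move=> x y; rewrite -{1}(autVK a x) -{1}(autVK a y) -autM autK. Qed.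

Definition aut_one : group_aut G :=
  @GroupAut G id id (fun _ _ => erefl) (fun _ => erefl) (fun _ => erefl).

Lemma aut_mulM a b : {morph (a \o b) : x y / x * y}.
Proof. by move=> x y; rewrite /= !autM. Qed.

(* Automorphisms compose as functions: (a * b) x = a (b x). *)
Definition aut_mul a b : group_aut G :=
  GroupAut (aut_mulM a b) (can_comp (autK a) (autK b))
           (can_comp (autVK b) (autVK a)).

Definition aut_invg a : group_aut G :=
  GroupAut (@aut_invM a) (autVK a) (autK a).

HB.instance Definition _ := gen_eqMixin (group_aut G).
HB.instance Definition _ := gen_choiceMixin (group_aut G).

Lemma aut_mulA : associative aut_mul.
Proof. by move=> a b c; apply: group_autP. Qed.
Lemma aut_mul1 : left_id aut_one aut_mul.
Proof. by move=> a; apply: group_autP. Qed.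
Lemma aut_mulr1 : right_id aut_one aut_mul.
Proof. by move=> a; apply: group_autP. Qed.
Lemma aut_mulV : left_inverse aut_one aut_invg aut_mul.
Proof. by move=> a; apply: group_autP => x; exact: autK. Qed.
Lemma aut_mulrV : right_inverse aut_one aut_invg aut_mul.
Proof. by move=> a; apply: group_autP => x; exact: autVK. Qed.

HB.instance Definition _ := isGroup.Build (group_aut G)
  aut_mulA aut_mul1 aut_mulr1 aut_mulV aut_mulrV.
End AutGroup.

(* A finite simplicial graph is a symmetric irreflexive relation on a finType;
   a full subgraph is identified with its set of vertices. *)

Section Graphs.
Variables (V : finType) (e : rel V).

Definition lk (v : V) : {set V} := [set w | e v w]%SET.

Definition st (v : V) : {set V} := (v |: lk v)%SET.

(* d(v, w) >= k, where d is the edge-path distance, infinite when no path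
   joins v to w. *)
Definition dist_ge (k : nat) (v w : V) : Prop :=
  forall p : seq V, path e v p -> last v p = w -> (k <= size p)%N.

(* The vertex sets of the connected components of the full subgraph
   spanned by B. *)
Definition components (B : {set V}) : {set {set V}} :=
  equivalence_partition
    (connect [rel x y | [&& e x y, x \in B & y \in B]]) B.

Definition has_SIL : Prop :=
  exists v w C, [/\ dist_ge 2 v w, C \in components (~: (lk v :&: lk w))%SET,
                    v \notin C & w \notin C].

Definition is_complete (T : {set V}) : bool :=
  [forall v in T, forall w in T, (v != w) ==> e v w].

(* The complement of the star of a cone vertex v is empty, so no partial
   conjugation pi_(v, C) exists and every partial conjugation fixes G_v. *)
Definition cone_vertex (v : V) : bool := st v == [set: V]%SET.

End Graphs.

Section GraphProduct.
Variables (V : finType) (e : rel V) (G : V -> finGroupType).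

Definition word := seq {v : V & G v}.

Definition letter (v : V) (a : G v) : {v : V & G v} := Tagged G a.

Inductive gp_step : word -> word -> Prop :=
| gp_step1 l r v :
    gp_step (l ++ letter (1 : G v) :: r) (l ++ r)
| gp_stepM l r v (a b : G v) :
    gp_step (l ++ [:: letter a, letter b & r]) (l ++ letter (a * b) :: r)
| gp_stepC l r v w (a : G v) (b : G w) : e v w ->
    gp_step (l ++ [:: letter a, letter b & r])
            (l ++ [:: letter b, letter a & r]).

Definition gp_eq : word -> word -> Prop := clos_refl_sym_trans word gp_step.

Definition gp_eqb : rel word := fun w1 w2 => `[< gp_eq w1 w2 >].

Lemma gp_eqb_refl : reflexive gp_eqb.
Proof. by move=> w; apply/asboolP; exact: rst_refl. Qed.
Lemma gp_eqb_sym : symmetric gp_eqb.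
Proof. by move=> w1 w2; apply/asboolP/asboolP; exact: rst_sym. Qed.
Lemma gp_eqb_trans : transitive gp_eqb.
Proof.
by move=> w2 w1 w3 /asboolP h /asboolP k; apply/asboolP; exact: rst_trans h k.
Qed.

Canonical gp_eqb_equiv := EquivRel gp_eqb gp_eqb_refl gp_eqb_sym gp_eqb_trans.

Definition graph_product := {eq_quot gp_eqb}%qT.

HB.instance Definition _ := Choice.on graph_product.
HB.instance Definition _ := EqQuotient.on graph_product.

Definition gp_class (w : word) : graph_product := (\pi_graph_product w)%qT.

Lemma gp_classP w1 w2 : gp_eq w1 w2 <-> gp_class w1 = gp_class w2.
Proof.
rewrite /gp_class; split => [h|/eqmodP/asboolP//].
by apply/eqmodP/asboolP.
Qed.

Definition word_inv (w : word) : word :=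
  rev [seq letter (tagged s : G (tag s))^-1 | s : {v & G v} <- w].

Lemma gp_eq_cat w1 w2 u1 u2 :
  gp_eq w1 w2 -> gp_eq u1 u2 -> gp_eq (w1 ++ u1) (w2 ++ u2).
Proof.
move=> h k; apply: (@rst_trans _ _ _ (w2 ++ u1)).
  elim: h => {w1 w2 k u2} [w1 w2 []|w|w1 w2 _|w1 w2 w3 _ h1 _ h2].
  - by move=> l r v; rewrite -!catA /=; apply: rst_step; exact: gp_step1.
  - by move=> l r v a b; rewrite -!catA /=; apply: rst_step; exact: gp_stepM.
  - move=> l r v w a b vw; rewrite -!catA /=.
    by apply: rst_step; exact: gp_stepC.
  - exact: rst_refl.
  - exact: rst_sym.
  - exact: rst_trans h1 h2.
elim: k => {u1 u2 h w1} [u1 u2 []|w|u1 u2 _|u1 u2 u3 _ h1 _ h2].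
- by move=> l r v; rewrite !catA; apply: rst_step; exact: gp_step1.
- by move=> l r v a b; rewrite !catA; apply: rst_step; exact: gp_stepM.
- by move=> l r v w a b vw; rewrite !catA; apply: rst_step; exact: gp_stepC.
- exact: rst_refl.
- exact: rst_sym.
- exact: rst_trans h1 h2.
Qed.

Lemma gp_eq_invl w : gp_eq (word_inv w ++ w) [::].
Proof.
elim: w => [|[v a] w IH]; first exact: rst_refl.
rewrite /word_inv /= rev_cons -cats1 -catA /=.
apply: (rst_trans _ _ _ _ _ _ IH); set u := rev _.
apply: (@rst_trans _ _ _ (u ++ letter (a^-1 * a) :: w)).
  by apply: rst_step; exact: gp_stepM.
by rewrite mulVg; apply: rst_step; exact: gp_step1.
Qed.

Lemma gp_eq_invr w : gp_eq (w ++ word_inv w) [::].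
Proof.
have invK : word_inv (word_inv w) = w.
  rewrite /word_inv map_rev revK -map_comp -[RHS]map_id.
  by apply: eq_map => -[v a] /=; rewrite /letter /= invgK.
by rewrite -{1}invK; exact: gp_eq_invl.
Qed.

Definition gp_one : graph_product := gp_class [::].
Definition gp_mul (x y : graph_product) : graph_product :=
  gp_class (repr x ++ repr y).
Definition gp_inv (x : graph_product) : graph_product :=
  gp_class (word_inv (repr x)).

Lemma gp_reprK (x : graph_product) : gp_class (repr x) = x.
Proof. exact: reprK. Qed.

Lemma gp_repr_class w : gp_eq (repr (gp_class w)) w.
Proof. by apply/gp_classP; rewrite gp_reprK. Qed.

Lemma gp_mul_class w1 w2 :
  gp_mul (gp_class w1) (gp_class w2) = gp_class (w1 ++ w2).
Proof. by apply/gp_classP/gp_eq_cat; exact: gp_repr_class. Qed.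

Lemma gp_mulA : associative gp_mul.
Proof.
move=> x y z; rewrite -(gp_reprK x) -(gp_reprK y) -(gp_reprK z).
by rewrite !gp_mul_class catA.
Qed.
Lemma gp_mul1 : left_id gp_one gp_mul.
Proof. by move=> x; rewrite -(gp_reprK x) gp_mul_class. Qed.
Lemma gp_mulr1 : right_id gp_one gp_mul.
Proof. by move=> x; rewrite -(gp_reprK x) gp_mul_class cats0. Qed.
Lemma gp_mulV : left_inverse gp_one gp_inv gp_mul.
Proof.
move=> x; rewrite -{2}(gp_reprK x) gp_mul_class.
by apply/gp_classP; exact: gp_eq_invl.
Qed.
Lemma gp_mulrV : right_inverse gp_one gp_inv gp_mul.
Proof.
move=> x; rewrite -{1}(gp_reprK x) gp_mul_class.
by apply/gp_classP; exact: gp_eq_invr.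
Qed.

HB.instance Definition _ := isGroup.Build graph_product
  gp_mulA gp_mul1 gp_mulr1 gp_mulV gp_mulrV.

Definition gp_in (v : V) (a : G v) : graph_product := gp_class [:: letter a].

Definition gp_sub (T : {set V}) : set graph_product :=
  subgroup_gen (\bigcup_(v in [set` T]) range (@gp_in v)).

End GraphProduct.

Arguments gp_sub {V} e G T _.

Section Complex.
Variables (R : realType) (V : finType) (e : rel V) (G : V -> finGroupType).
Local Open Scope ring_scope.

Local Notation GL := (graph_product e G).

Definition complete_coset (A : set GL) : Prop :=
  exists (g : GL) (T : {set V}),
    is_complete e T /\ A = left_coset g (gp_sub e G T).

(* A point of the geometric realization of the poset of cosets, given by its
   barycentric coordinates. *)
Record complex := Complex {
  wt :> set GL -> R;
  wt_ge0 : forall A, 0 <= wt A;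
  wt_coset : forall A, wt A != 0 -> complete_coset A;
  wt_chain : forall A B, wt A != 0 -> wt B != 0 -> A `<=` B \/ B `<=` A;
  wt_finite : finite_set [set A | wt A != 0];
  wt_sum : \sum_(A \in [set: set GL]) wt A = 1 }.

(* The cube g[G_T1, G_T2] has vertices g G_S for T1 \subset S \subset T2. It is
   identified with the unit cube of R^(T2 :\: T1) by sending g G_S to the
   indicator function of S :\: T1 and extending affinely on simplices.  The
   g G_S are pairwise distinct when the vertex groups are nontrivial. *)
Definition in_cube (g : GL) (T1 T2 : {set V}) (x : complex) : Prop :=
  forall A, x A != 0 -> exists S : {set V},
    [/\ T1 \subset S, S \subset T2 & A = left_coset g (gp_sub e G S)].

Definition cube_coord (g : GL) (T1 T2 : {set V}) (x : complex) (v : V) : R :=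
  \sum_(S : {set V} | [&& T1 \subset S, S \subset T2 & v \in S])
    x (left_coset g (gp_sub e G S)).

Definition cube_dist (g : GL) (T1 T2 : {set V}) (x y : complex) : R :=
  Num.sqrt (\sum_(v in T2 :\: T1)
    (cube_coord g T1 T2 x v - cube_coord g T1 T2 y v) ^+ 2).

(* The possible lengths of piecewise linear paths from x to y, each piece being
   a segment in a single cube; the path metric is their infimum. *)
Inductive path_length : complex -> complex -> R -> Prop :=
| path_length0 x : path_length x x 0
| path_lengthS g (T1 T2 : {set V}) x y z l :
    is_complete e T2 -> T1 \subset T2 ->
    in_cube g T1 T2 x -> in_cube g T1 T2 y ->
    path_length y z l -> path_length x z (cube_dist g T1 T2 x y + l).

Definition complex_dist (x y : complex) : \bar R :=
  ereal_inf [set l%:E | l in path_length x y].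

Definition complex_ball (x : complex) (r : R) : set complex :=
  [set y | (complex_dist x y < r%:E)%E].

Lemma cube_distC g T1 T2 x y : cube_dist g T1 T2 x y = cube_dist g T1 T2 y x.
Proof.
by congr Num.sqrt; apply: eq_bigr => v _; rewrite -sqrrN opprB.
Qed.

Lemma path_length_cat x y z l m :
  path_length x y l -> path_length y z m -> path_length x z (l + m).
Proof.
move=> p; elim: p z m => {x y l} [x|g T1 T2 x y z l cT sT xc yc _ IH] u m.
  by rewrite add0r.
by move=> q; rewrite -addrA; apply: path_lengthS => //; exact: IH.
Qed.

Lemma path_length_sym x y l : path_length x y l -> path_length y x l.
Proof.
elim=> {x y l} [x|g T1 T2 x y z l cT sT xc yc _ IH]; first exact: path_length0.
rewrite addrC cube_distC; apply: path_length_cat IH _.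
by rewrite -[cube_dist _ _ _ _ _]addr0; apply: path_lengthS => //;
   exact: path_length0.
Qed.

Lemma complex_ballP x r y :
  complex_ball x r y <-> exists2 l, path_length x y l & l < r.
Proof.
split=> [/ereal_inf_lt[_ [l xyl <-]]|[l xyl lr]].
  by rewrite lte_fin => lr; exists l.
by apply: (@le_lt_trans _ _ l%:E); [apply: ereal_inf_lbound; exists l|].
Qed.

Lemma complex_ball_center x (r : R) : 0 < r -> complex_ball x r x.
Proof. by move=> r0; apply/complex_ballP; exists 0 => //; left. Qed.

Lemma complex_ball_sym x y (r : R) : complex_ball x r y -> complex_ball y r x.
Proof.
by move=> /complex_ballP[l /path_length_sym ? ?]; apply/complex_ballP; exists l.
Qed.

Lemma complex_ball_triangle x y z (r s : R) :
  complex_ball x r y -> complex_ball y s z -> complex_ball x (r + s) z.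
Proof.
move=> /complex_ballP[l xy lr] /complex_ballP[m yz ms]; apply/complex_ballP.
by exists (l + m); [exact: path_length_cat xy yz|exact: ltrD].
Qed.

HB.instance Definition _ := gen_eqMixin complex.
HB.instance Definition _ := gen_choiceMixin complex.
HB.instance Definition _ :=
  hasNbhs.Build complex (nbhs_ (entourage_ complex_ball)).
HB.instance Definition _ := Nbhs_isPseudoMetric.Build R complex
  erefl complex_ball_center complex_ball_sym complex_ball_triangle erefl.

Variables (A : groupType) (H : set A) (act : A -> complex -> complex).

Definition is_group_action : Prop :=
  (forall x, act 1%g x = x) /\
  (forall a b, H a -> H b -> forall x, act (a * b)%g x = act a (act b x)).

Definition faithful_action : Prop :=
  forall a, H a -> (forall x, act a x = x) -> a = 1%g.

Definition isometric_action : Prop :=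
  forall a, H a -> forall x y,
    complex_dist (act a x) (act a y) = complex_dist x y.

Definition proper_action : Prop :=
  forall x : complex, exists2 r : R, 0 < r &
    finite_set [set a | H a /\ (act a @` ball x r) `&` ball x r !=set0].

Definition cocompact_action : Prop :=
  exists2 K : set complex, compact K &
    forall x, exists a y, [/\ H a, K y & x = act a y].

Definition geometric_action : Prop :=
  [/\ proper_action, cocompact_action & isometric_action].

End Complex.

Section Automorphisms.
Variables (V : finType) (e : rel V) (G : V -> finGroupType).
Variable gen : forall v, G v.

Local Notation GG := (graph_product e G).

Definition gp_gen (v : V) : GG := gp_in e (gen v).

Definition is_partial_conj (v : V) (C : {set V}) (a : group_aut GG) : Prop :=
  forall w, 
    a (gp_gen w) = if w \in C then gp_gen v * gp_gen w * (gp_gen v)^-1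
                   else gp_gen w.

Definition is_graph_symmetry (a : group_aut GG) : Prop :=
  exists2 s : {perm V}, (forall v w, e (s v) (s w) = e v w) &
    forall v, a (gp_gen v) = gp_gen (s v).

Definition is_vertex_iso (a : group_aut GG) : Prop :=
  exists v (b : group_aut (G v)),
    (forall c, a (gp_in e c) = gp_in e (b c)) /\
    (forall w, w != v -> a (gp_gen w) = gp_gen w).

Definition partial_conjs : set (group_aut GG) :=
  [set a | exists v C, C \in components e (~: st e v)%SET /\
                       is_partial_conj v C a].

Definition Aut_pc : set (group_aut GG) := subgroup_gen partial_conjs.

Definition Sigma : set (group_aut GG) :=
  subgroup_gen [set a | is_graph_symmetry a \/ is_vertex_iso a].

Definition Aut_pc_Sigma : set (group_aut GG) :=
  subgroup_gen (partial_conjs `|`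
             [set a | is_graph_symmetry a \/ is_vertex_iso a]).

Definition tvertex : finType :=
  {p : V * {set V} | p.2 \in components e (~: st e p.1)%SET}.

Definition tbase (p : tvertex) : V := (val p).1.
Definition tcomp (p : tvertex) : {set V} := (val p).2.

Definition tedge : rel tvertex := fun p q =>
  (p != q) && ~~ [&& `[< dist_ge e 2 (tbase p) (tbase q) >],
                     tbase p \in tcomp q & tbase q \in tcomp p].

(* p_(v, C) is labelled by a copy of G v, whose order is |v|. *)
Definition tgroup (p : tvertex) : finGroupType := G (tbase p).

Definition tproduct := graph_product tedge tgroup.

Definition tgen (p : tvertex) : tproduct :=
  gp_in tedge (gen (tbase p) : tgroup p).

End Automorphisms.

Arguments partial_conjs {V} e {G} gen _.
Arguments Aut_pc {V} e {G} gen _.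
Arguments Sigma {V} e {G} gen _.
Arguments Aut_pc_Sigma {V} e {G} gen _.
Arguments tgroup {V} e G p.
Arguments tedge {V} e p q.
Arguments tgen {V} e {G} gen p.

(* Main.v *)
(* Conjugating C by v, for a component C of the complement of st v, defines a
   homomorphism phi from the graph product over tilde Gamma to Aut^pc: absence
   of SILs forces components of the complements of st v and st w, d(v, w) >= 2,
   to be nested or disjoint unless each contains the other's base point.

   phi is injective because the inner automorphisms lift: iota sends v to the
   product of the p_(v, C) over all C, and g iota(y) g^-1 = iota(phi(g) y).  The
   image of iota is normal with abelian quotient, so that an element of ker phi,
   whose exponents all vanish, is some iota(y); then y is central, hence a
   product of letters at cone vertices, all killed by iota.

   H = Aut^pc x| Sigma acts on H / Sigma, which phi identifies with the vertices
   {g} of the complex, and this action permutes the cosets g G_T.  Properness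
   comes from the finiteness of Sigma and of the G_T, T a clique, because the
   total weight of the cosets containing h is a 1-Lipschitz function. *)
From HB Require Import structures.
Require Import Defs.
From Stdlib Require Import Relation_Operators.
From mathcomp Require Import all_boot all_order all_algebra all_fingroup.
From mathcomp Require Import generic_quotient.
From mathcomp Require Import all_classical all_reals all_analysis.
Set Implicit Arguments.
Unset Strict Implicit.
Unset Printing Implicit Defensive.
Local Open Scope classical_set_scope.
Local Open Scope group_scope.

(** * Groups and graph products *)

(** Commutators of letters lie in the image of [iota] because [iota v] is p_(v, C) times letters at
    the other components, which commute with p_(w, D) as soon as w is in C. A kernel element has
    vanishing exponents because each p_(v, C) shows on a vertex x of C: the automorphism conjugates
    G x by an element with the same v-exponent, and v, x are not adjacent. Only the centre needs a
    normal form. The path metric is an infimum over piecewise linear paths, so the difficulty in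
    properness is to bound distances from below; a function that changes by at most the length of
    each single segment does this without any knowledge of geodesics. Faithfulness can fail only at
    cone vertices, which leave no trace in the tilde graph: an automorphism of G_v for a cone vertex
    v, or the exchange of two cone vertices of equal order, commutes with all partial conjugations
    and so acts trivially. Hence the condition of at most one cone vertex, of order 2. *)

Section Subgroups.
Variable A : groupType.
Implicit Types (S H : set A).

Lemma is_subgroup1 H : is_subgroup H -> H 1. Proof. by case. Qed.

Lemma is_subgroupV H x : is_subgroup H -> H x -> H x^-1.
Proof. by move=> [H1 HM] Hx; rewrite -[x^-1]mul1g; exact: HM. Qed.

Lemma is_subgroupM H x y : is_subgroup H -> H x -> H y -> H (x * y).
Proof.
by move=> sH Hx Hy; rewrite -[y]invgK; apply: sH.2 => //; exact: is_subgroupV.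
Qed.

Lemma is_subgroupX H x n : is_subgroup H -> H x -> H (x ^+ n).
Proof.
move=> sH Hx; elim: n => [|n IH]; first by rewrite expg0; exact: is_subgroup1.
by rewrite expgS; exact: is_subgroupM.
Qed.

Lemma subgroup_gen_is_subgroup S : is_subgroup (subgroup_gen S).
Proof.
split=> [H [[]]//|x y Sx Sy H [sH SH]].
by apply: sH.2; [exact: Sx|exact: Sy].
Qed.

Lemma sub_subgroup_gen S : S `<=` subgroup_gen S.
Proof. by move=> x Sx H [_]; exact. Qed.

Lemma subgroup_gen_min S H : is_subgroup H -> S `<=` H -> subgroup_gen S `<=` H.
Proof. by move=> sH SH x; apply. Qed.

Lemma left_cosetE g S x : left_coset g S x <-> S (g^-1 * x).
Proof.
split=> [[y Sy <-]|Sx]; first by rewrite mulKg.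
by exists (g^-1 * x) => //; rewrite mulVKg.
Qed.

Lemma left_coset1 S : left_coset 1 S = S.
Proof. by apply/seteqP; split=> x; rewrite left_cosetE invg1 mul1g. Qed.

Lemma left_coset_refl g H : is_subgroup H -> left_coset g H g.
Proof. by case=> H1 _; rewrite left_cosetE mulVg. Qed.

Lemma left_coset_eq g h H :
  is_subgroup H -> left_coset g H h -> left_coset g H = left_coset h H.
Proof.
move=> sH; rewrite left_cosetE => Hgh; apply/seteqP; split=> x.
  rewrite !left_cosetE => Hx.
  have -> : h^-1 * x = (g^-1 * h)^-1 * (g^-1 * x).
    by rewrite !gnorm.
  by apply: is_subgroupM => //; exact: is_subgroupV.
rewrite !left_cosetE => Hx.
have -> : g^-1 * x = (g^-1 * h) * (h^-1 * x) by rewrite !gnorm.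
exact: is_subgroupM.
Qed.

End Subgroups.

Section Morphisms.
Variables (A B : groupType) (f : A -> B).
Hypothesis fM : {morph f : x y / x * y}.

Lemma gmorph1 : f 1 = 1.
Proof. by apply: (mulgI (f 1)); rewrite -fM !mulg1. Qed.

Lemma gmorphV x : f x^-1 = (f x)^-1.
Proof. by apply: (mulgI (f x)); rewrite -fM !mulgV gmorph1. Qed.

Lemma gmorphX x n : f (x ^+ n) = f x ^+ n.
Proof.
by elim: n => [|n IH]; rewrite ?expg0 ?gmorph1// !expgS fM IH.
Qed.

Lemma gmorph_prod (I : Type) (r : seq I) (F : I -> A) :
  f (\prod_(i <- r) F i) = \prod_(i <- r) f (F i).
Proof. by elim: r => [|i r IH]; rewrite ?big_nil ?gmorph1// !big_cons fM IH. Qed.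

End Morphisms.

Lemma prod_seq1 (A : groupType) (I : eqType) (r : seq I) (F : I -> A) i :
  uniq r -> (forall j, j != i -> F j = 1) ->
  \prod_(j <- r) F j = if i \in r then F i else 1.
Proof.
move=> + Fi; elim: r => [|j r IH]; first by rewrite big_nil.
rewrite big_cons inE => /= /andP[jr ur]; rewrite IH//.
have [->|ij] := eqVneq i j; first by rewrite (negbTE jr) mulg1.
by rewrite Fi 1?eq_sym// mul1g.
Qed.

Section GraphProductTheory.
Variables (V : finType) (e : rel V) (G : V -> finGroupType).
Local Notation GG := (graph_product e G).

Lemma gp_class_cons (l : {v : V & G v}) w :
  gp_class e (l :: w) = gp_in e (tagged l) * gp_class e w :> GG.
Proof.
rewrite [RHS]gp_mul_class; congr gp_class; by case: l.
Qed.

Lemma gp_ind (P : GG -> Prop) :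
  P 1 -> (forall v (a : G v) x, P x -> P (gp_in e a * x)) -> forall x, P x.
Proof.
move=> P1 PM x; rewrite -(gp_reprK x); elim: (repr x) => [//|l w IH].
by rewrite gp_class_cons; exact: PM.
Qed.

Lemma gp_inM v : {morph @gp_in V e G v : a b / a * b}.
Proof.
move=> a b; rewrite [RHS]gp_mul_class; apply/gp_classP; apply: rst_sym.
by apply: rst_step; exact: (@gp_stepM _ _ _ [::] [::]).
Qed.

Lemma gp_in1 v : gp_in e (1 : G v) = 1.
Proof. exact: (gmorph1 (@gp_inM v)). Qed.

Lemma gp_inV v (a : G v) : gp_in e a^-1 = (gp_in e a)^-1.
Proof. exact: (gmorphV (@gp_inM v)). Qed.

Lemma gp_in_comm v w (a : G v) (b : G w) : e v w ->
  commute (gp_in e a) (gp_in e b).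
Proof.
move=> vw; rewrite /commute [LHS]gp_mul_class [RHS]gp_mul_class.
by apply/gp_classP/rst_step; exact: (@gp_stepC _ _ _ [::] [::]).
Qed.

(** * The universal property of a graph product *)

Section Lift.
Variables (M : groupType) (f : forall v, G v -> M).
Hypothesis fM : forall v, {morph @f v : a b / a * b}.
Hypothesis fC : forall v w (a : G v) (b : G w), e v w -> commute (f a) (f b).

Definition gp_lift (x : GG) : M := \prod_(l <- repr x) f (tagged l).

Lemma gp_lift_class w : gp_lift (gp_class e w) = \prod_(l <- w) f (tagged l).
Proof.
suff h u w' : gp_eq e u w' ->
    \prod_(l <- u) f (tagged l) = \prod_(l <- w') f (tagged l).
  exact/h/gp_repr_class.
elim=> {u w'} [x y []|//|x y _ -> //|].
- by move=> l r v; rewrite !big_cat big_cons /= (gmorph1 (@fM _)) mul1g.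
- by move=> l r v a b; rewrite !big_cat !big_cons /= fM !mulgA.
- move=> l r v u a b vu; rewrite !big_cat !big_cons /=; congr (_ * _).
  by rewrite !mulgA fC.
- by move=> x y z _ -> _ ->.
Qed.

Lemma gp_liftM : {morph gp_lift : x y / x * y}.
Proof.
move=> x y; rewrite -(gp_reprK x) -(gp_reprK y).
have -> : gp_class e (repr x) * gp_class e (repr y) =
          gp_class e (repr x ++ repr y) by exact: gp_mul_class.
by rewrite !gp_lift_class big_cat.
Qed.

Lemma gp_lift_in v (a : G v) : gp_lift (gp_in e a) = f a.
Proof. by rewrite gp_lift_class big_seq1. Qed.

End Lift.

Lemma gp_morph_ext (M : groupType) (f g : GG -> M) :
  {morph f : x y / x * y} -> {morph g : x y / x * y} ->
  (forall v (a : G v), f (gp_in e a) = g (gp_in e a)) -> f =1 g.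
Proof.
move=> fM gM fg; apply: gp_ind; first by rewrite !gmorph1.
by move=> v a x IH; rewrite fM gM fg IH.
Qed.

(** The default value 1 makes this a morphism for every pair of vertices, so that it can be fed to
    [gp_lift]. *)
Definition vcast (v w : V) (a : G w) : G v :=
  if @eqP _ w v is ReflectT E then ecast u (G u) E a else 1.

Lemma vcast_id v (a : G v) : vcast v a = a.
Proof. by rewrite /vcast; case: eqP => // E; rewrite eq_axiomK. Qed.

Lemma vcast_neq v w (a : G w) : w != v -> vcast v a = 1.
Proof. by rewrite /vcast; case: eqP. Qed.

Lemma vcastM v w : {morph @vcast v w : a b / a * b}.
Proof.
move=> a b; have [<-|wv] := eqVneq w v; first by rewrite !vcast_id.
by rewrite !vcast_neq// mulg1.
Qed.

(** For irreflexive [e], the retraction onto the factor [G v]: the total exponent of v in a word. *)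
Definition gp_expt (v : V) : GG -> G v := gp_lift (@vcast v).

Hypothesis e_irr : irreflexive e.

Lemma vcastC v u w (a : G u) (b : G w) : e u w ->
  commute (vcast v a) (vcast v b).
Proof.
have [wv uw|wv _] := eqVneq w v; last by rewrite (vcast_neq b)//; exact: commute1.
have uv : u != v by apply: contraTneq uw => ->; rewrite wv e_irr.
by rewrite (vcast_neq a)//; exact/commute_sym/commute1.
Qed.

Lemma gp_exptM v : {morph gp_expt v : x y / x * y}.
Proof. by apply: gp_liftM; [exact: vcastM|exact: vcastC]. Qed.

Lemma gp_expt_in v (a : G v) : gp_expt v (gp_in e a) = a.
Proof.
by rewrite /gp_expt gp_lift_in ?vcast_id//; [exact: vcastM|exact: vcastC].
Qed.

Lemma gp_expt_neq v w (a : G w) : w != v -> gp_expt v (gp_in e a) = 1.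
Proof.
move=> wv; rewrite /gp_expt gp_lift_in ?vcast_neq//.
  exact: vcastM.
exact: vcastC.
Qed.

Lemma gp_in_inj v w (a : G v) (b : G w) : a != 1 ->
  gp_in e a = gp_in e b -> letter a = letter b.
Proof.
move=> a1 ab; have := gp_expt_in a; rewrite ab.
have [E|wv] := eqVneq w v; last by rewrite gp_expt_neq// => /esym/eqP/negPn; rewrite a1.
by case: _ / E a a1 ab => a _ _; rewrite gp_expt_in => ->.
Qed.

Lemma gp_sub_is_subgroup T : is_subgroup (gp_sub e G T).
Proof. exact: subgroup_gen_is_subgroup. Qed.

Lemma gp_sub_in (T : {set V}) v (a : G v) : v \in T -> gp_sub e G T (gp_in e a).
Proof. by move=> vT; apply: sub_subgroup_gen; exists v => //; exists a. Qed.

Lemma gp_sub_min (T : {set V}) (H : set GG) : is_subgroup H ->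
  (forall v (a : G v), v \in T -> H (gp_in e a)) -> gp_sub e G T `<=` H.
Proof.
move=> sH TH; apply: subgroup_gen_min => // x [v vT [a _ <-]]; exact: TH.
Qed.

Lemma gp_subS (S T : {set V}) : S \subset T -> gp_sub e G S `<=` gp_sub e G T.
Proof.
move=> /fintype.subsetP ST; apply: gp_sub_min; first exact: gp_sub_is_subgroup.
by move=> v a vS; apply: gp_sub_in; exact: ST.
Qed.

Lemma gp_sub_setT x : gp_sub e G [set: V]%SET x.
Proof.
elim/gp_ind: x => [|v a x IH]; first exact: (gp_sub_is_subgroup _).1.
by apply: (is_subgroupM (gp_sub_is_subgroup _)) => //; exact: gp_sub_in.
Qed.

Lemma gp_sub_ind (T : {set V}) (P : GG -> Prop) :
  P 1 -> (forall v (a : G v) x, v \in T -> gp_sub e G T x -> P x ->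
    P (gp_in e a * x)) ->
  forall x, gp_sub e G T x -> P x.
Proof.
move=> P1 PM x Tx.
(* A smallest subgroup offers no induction over words; the elements spelled by words over T form a
   subgroup, which supplies one. *)
pose Q := [set x | exists2 w : word G, all (fun l => tag l \in T) w &
                     x = gp_class e w].
have [w + ->] : Q x.
  apply: gp_sub_min Tx; last first.
    by move=> v a vT; exists [:: letter a] => //=; rewrite vT.
  split; first by exists [::].
  move=> _ _ [w Tw ->] [u Tu ->]; exists (w ++ word_inv u).
    rewrite all_cat Tw all_rev all_map; apply: sub_all Tu => l; exact.
  rewrite -gp_mul_class; congr (_ * _).
  have uV : gp_class e u * gp_class e (word_inv u) = 1.
    by rewrite [LHS]gp_mul_class; apply/gp_classP/gp_eq_invr.
  by apply: (mulgI (gp_class e u)); rewrite uV mulgV.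
elim: w => [//|l w IH] /= /andP[lT wT]; rewrite gp_class_cons.
suff [] : gp_sub e G T (gp_class e w) /\ P (gp_class e w) by move=> ? ?; exact: PM.
split; last exact: IH.
elim: w wT {IH} => [_|k w IH /= /andP[kT wT]]; first exact: (gp_sub_is_subgroup _).1.
rewrite gp_class_cons; apply: (is_subgroupM (gp_sub_is_subgroup _)).
  exact: gp_sub_in.
exact: IH.
Qed.

Lemma gp_sub_expt (T : {set V}) v x : v \notin T -> gp_sub e G T x ->
  gp_expt v x = 1.
Proof.
move=> vT; move: x; apply: gp_sub_ind; first exact: (gmorph1 (@gp_exptM v)).
move=> w a x wT _ xv; rewrite gp_exptM xv mulg1 gp_expt_neq//.
by apply: contraNneq vT => <-.
Qed.

(* The canonical form of an element modulo a normal subgroup N containing the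
   commutators of the letters over T; N is trivial when T is a clique. *)
Definition gp_normal (x : GG) : GG := \prod_(v : V) gp_in e (gp_expt v x).

Section Normal.
Variables (T : {set V}) (N : set GG).
Hypothesis sN : is_subgroup N.
Hypothesis nN : forall g n, N n -> N (g * n * g^-1).
Hypothesis cN : forall v w (a : G v) (b : G w), v \in T -> w \in T ->
  N (gp_in e a * gp_in e b * (gp_in e b * gp_in e a)^-1).

Let eqN x y := N (x * y^-1).

Let eqNref x : eqN x x.
Proof. by rewrite /eqN mulgV; exact: sN.1. Qed.

Let eqNtrans y x z : eqN x y -> eqN y z -> eqN x z.
Proof.
rewrite /eqN => xy yz; have -> : x * z^-1 = (x * y^-1) * (y * z^-1).
  by rewrite !gnorm.
exact: is_subgroupM.
Qed.

Let eqNM x y x' y' : eqN x y -> eqN x' y' -> eqN (x * x') (y * y').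
Proof.
move=> xy xy'; apply: (@eqNtrans (x * y')); rewrite /eqN.
  have -> : x * x' * (x * y')^-1 = x * (x' * y'^-1) * x^-1.
    by rewrite !gnorm.
  exact: nN.
by have -> : x * y' * (y * y')^-1 = x * y^-1; rewrite // !gnorm.
Qed.

Let eqNsym x y : eqN x y -> eqN y x.
Proof. by rewrite /eqN => /(is_subgroupV sN); rewrite invgM invgK. Qed.

Let eqN_comm_in v (a : G v) x : v \in T -> gp_sub e G T x ->
  eqN (gp_in e a * x) (x * gp_in e a).
Proof.
move=> vT; move: x; apply: gp_sub_ind; first by rewrite mulg1 mul1g.
move=> w b x wT _ IH; apply: (@eqNtrans (gp_in e b * gp_in e a * x)).
  rewrite mulgA; apply: eqNM => //; exact: cN.
by rewrite -!mulgA; apply: eqNM.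
Qed.

Let gp_sub_gp_in_expt v x : gp_sub e G T x -> gp_sub e G T (gp_in e (gp_expt v x)).
Proof.
move=> Tx; have [vT|vT] := boolP (v \in T); first exact: gp_sub_in.
by rewrite (gp_sub_expt vT)// gp_in1; exact: (gp_sub_is_subgroup _).1.
Qed.

(** Modulo N the letters over T commute, so a word can be sorted by vertices; a new letter on the
    left only affects the factor at its own vertex. *)
Lemma gp_normalP x : gp_sub e G T x -> N (x * (gp_normal x)^-1).
Proof.
move: x; apply: gp_sub_ind.
  rewrite /gp_normal big1 ?mulgV; first exact: sN.1.
  by move=> v _; rewrite (gmorph1 (@gp_exptM v)) gp_in1.
move=> v a x vT Tx IH; rewrite -/(eqN _ _).
apply: (@eqNtrans (gp_in e a * gp_normal x)); first exact: eqNM.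
apply: eqNsym; rewrite /gp_normal.
(* Generalised to a duplicate-free list [r], which [a] enters only if v occurs in it; induction
   carries [a] past the factors before v. *)
suff h r : uniq r -> eqN (\prod_(w <- r) gp_in e (gp_expt w (gp_in e a * x)))
    ((if v \in r then gp_in e a else 1) *
      \prod_(w <- r) gp_in e (gp_expt w x)).
  by have := h (index_enum V) (index_enum_uniq V); rewrite mem_index_enum.
elim: r => [|w r IHr]; first by rewrite !big_nil mulg1.
move=> /= /andP[wr /IHr{}IHr]; have wr0 := wr; rewrite !big_cons inE gp_exptM gp_inM.
case: (eqVneq v w) wr0 => [<-|vw] wr0.
  rewrite gp_expt_in /= -!mulgA; apply: eqNM => //; apply: eqNM => //.
  by rewrite (negbTE wr0) mul1g in IHr.
rewrite gp_expt_neq// gp_in1 mul1g /=.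
case: ifP IHr => _ IHr; last by rewrite !mul1g; rewrite mul1g in IHr; apply: eqNM.
apply: (@eqNtrans (gp_in e (gp_expt w x) *
  (gp_in e a * \prod_(w <- r) gp_in e (gp_expt w x)))); first exact: eqNM.
rewrite !mulgA; apply: eqNM => //; apply: eqNsym.
by apply: eqN_comm_in => //; exact: gp_sub_gp_in_expt.
Qed.

End Normal.

End GraphProductTheory.

(** * Piles and the center of a graph product *)

Section Piles.
Variables (V : finType) (e : rel V) (G : V -> finGroupType).
Hypotheses (e_sym : symmetric e) (e_irr : irreflexive e).
Local Notation GG := (graph_product e G).

(* A normal form for graph products: above each vertex v sits a stack whose
   entries are the letters at v and, marked [None], the letters at the vertices
   that do not commute with v. *)
Definition pile := V -> seq (option {v : V & G v}).

Definition pile0 : pile := fun _ => [::].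

Definition push v (a : G v) (P : pile) : pile := fun w =>
  if w == v then Some (letter a) :: P w else if e v w then P w else None :: P w.

Definition pop v (P : pile) : pile := fun w =>
  if e v w then P w else behead (P w).

Definition pushx v (a : G v) (P : pile) := if a == 1 then P else push a P.

Definition on_top (v : V) (P : pile) := if P v is Some _ :: _ then true else false.

Definition top v (P : pile) : G v :=
  if P v is Some l :: _ then vcast v (tagged l) else 1.

(** [pop] removes entries without looking at them, so this is a group action only on the piles of
    elements; hence the hypotheses [pile_of] below. *)
Definition pile_act v (a : G v) (P : pile) : pile :=
  if on_top v P then pushx (a * top v P) (pop v P) else pushx a P.

Definition pile_size (P : pile) := (\sum_v count isSome (P v))%N.

Lemma pushK v (a : G v) : cancel (push a) (pop v).
Proof.
move=> P; apply/funext => w; rewrite /pop /push.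
have [->|_] := eqVneq w v; first by rewrite e_irr.
by case: (e v w).
Qed.

Lemma on_top_push v (a : G v) P : on_top v (push a P).
Proof. by rewrite /on_top /push eqxx. Qed.

Lemma top_push v (a : G v) P : top v (push a P) = a.
Proof. by rewrite /top /push eqxx vcast_id. Qed.

Lemma on_top_push_adj v w (a : G v) P : e v w ->
  on_top w (push a P) = on_top w P.
Proof.
move=> vw; rewrite /on_top /push vw; case: eqVneq => // wv.
by rewrite wv e_irr in vw.
Qed.

Lemma on_top_push_nadj v w (a : G v) P : w != v -> ~~ e v w ->
  ~~ on_top w (push a P).
Proof. by rewrite /on_top /push => /negbTE -> /negbTE ->. Qed.

Lemma push_comm v w (a : G v) (b : G w) P : e v w ->
  push a (push b P) = push b (push a P).
Proof.
move=> vw; have vNw : v != w by apply: contraTneq vw => ->; rewrite e_irr.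
apply/funext => u; rewrite /push.
have [->|uv] := eqVneq u v.
  by rewrite e_sym vw (negbTE vNw).
have [->|uw] := eqVneq u w; first by rewrite vw.
by case: (e v u); case: (e w u).
Qed.

Lemma pile_act_pushx v (a b : G v) P : ~~ on_top v P ->
  pile_act a (pushx b P) = pushx (a * b) P.
Proof.
rewrite /pushx => nP; have [->|b1] := eqVneq b 1.
  by rewrite /pile_act (negbTE nP) mulg1.
by rewrite /pile_act on_top_push top_push pushK.
Qed.

Lemma pushx_comm v w (a : G v) (b : G w) P : e v w ->
  pushx a (pushx b P) = pushx b (pushx a P).
Proof. by move=> vw; rewrite /pushx; do 2 case: ifP => //; rewrite push_comm. Qed.

Lemma on_top_pushx_adj v w (a : G v) P : e v w ->
  on_top w (pushx a P) = on_top w P.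
Proof. by move=> vw; rewrite /pushx; case: ifP => // _; exact: on_top_push_adj. Qed.

Lemma pile_size_push v (a : G v) P : pile_size (push a P) = (pile_size P).+1.
Proof.
rewrite /pile_size (bigD1 v)//= [in RHS](bigD1 v)//= -addSn; congr addn.
  by rewrite /push eqxx.
by apply: eq_bigr => w /negbTE wv; rewrite /push wv; case: ifP.
Qed.

(* [pile_of x P]: P is the pile of some reduced word representing x. *)
Inductive pile_of : GG -> pile -> Prop :=
| pile_of1 : pile_of 1 pile0
| pile_of_push v (a : G v) x P : a != 1 -> ~~ on_top v P -> pile_of x P ->
    pile_of (gp_in e a * x) (push a P).

Lemma pile_ofx v (a : G v) x P : ~~ on_top v P -> pile_of x P ->
  pile_of (gp_in e a * x) (pushx a P).
Proof.
move=> nP xP; rewrite /pushx; have [->|a1] := eqVneq a 1.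
  by rewrite gp_in1 mul1g.
exact: pile_of_push.
Qed.

(** A letter at v on top of its stack commutes with all letters pushed after it, so it can be moved
    to the front; if v is blocked, the letter split off is 1. The case analysis in [pile_act]
    thereby becomes multiplication in [G v]. *)
Lemma pile_of_split v x P : pile_of x P -> exists (a : G v) y Q,
  [/\ ~~ on_top v Q, pile_of y Q, x = gp_in e a * y & P = pushx a Q].
Proof.
elim=> {x P} [|w a x P a1 nP xP [b [y [Q [nQ yQ xE PE]]]]].
  exists 1, 1, pile0; split=> //; first exact: pile_of1.
    by rewrite gp_in1 mulg1.
  by rewrite /pushx eqxx.
have [vw|vw] := eqVneq v w.
  case: _ / vw a a1 nP => a a1 nP; exists a, x, P; split=> //.
  by rewrite /pushx (negbTE a1).
have [ewv|ewv] := boolP (e w v); last first.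
  exists 1, (gp_in e a * x), (push a P); split.
  - exact: on_top_push_nadj.
  - exact: pile_of_push.
  - by rewrite gp_in1 mul1g.
  - by rewrite /pushx eqxx.
exists b, (gp_in e a * y), (push a Q); split.
- by rewrite on_top_push_adj.
- by apply: pile_of_push => //; rewrite PE on_top_pushx_adj 1?e_sym// in nP.
- by rewrite xE !mulgA gp_in_comm.
- rewrite PE /pushx; case: ifP => // _; exact: push_comm.
Qed.

Lemma pile_of_act v (a : G v) x P : pile_of x P ->
  pile_of (gp_in e a * x) (pile_act a P).
Proof.
move=> /(pile_of_split v)[b [y [Q [nQ yQ -> ->]]]].
rewrite pile_act_pushx// mulgA -gp_inM; exact: pile_ofx.
Qed.

Lemma pile_actM v (a b : G v) x P : pile_of x P ->
  pile_act a (pile_act b P) = pile_act (a * b) P.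
Proof.
move=> /(pile_of_split v)[c [y [Q [nQ yQ _ ->]]]].
by rewrite !pile_act_pushx// mulgA.
Qed.

Lemma pile_act1 v x P : pile_of x P -> pile_act (1 : G v) P = P.
Proof.
move=> /(pile_of_split v)[c [y [Q [nQ yQ _ ->]]]].
by rewrite pile_act_pushx// mul1g.
Qed.

(** Splitting at v and then at w turns the two actions into multiplications in independent
    coordinates. *)
Lemma pile_act_comm v w (a : G v) (b : G w) x P : e v w -> pile_of x P ->
  pile_act a (pile_act b P) = pile_act b (pile_act a P).
Proof.
move=> vw /(pile_of_split v)[c [y [Q [nQ yQ _ ->]]]].
have [d [z [S [nS zS _ QE]]]] := pile_of_split w yQ.
rewrite {}QE in nQ yQ *; have wv : e w v by rewrite e_sym.
rewrite on_top_pushx_adj// in nQ.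
have actv (a' c' : G v) (d' : G w) : pile_act a' (pushx c' (pushx d' S)) =
    pushx (a' * c') (pushx d' S).
  by rewrite pile_act_pushx ?on_top_pushx_adj//.
have actw (c' : G v) (b' d' : G w) : pile_act b' (pushx c' (pushx d' S)) =
    pushx c' (pushx (b' * d') S).
  by rewrite pushx_comm// pile_act_pushx ?on_top_pushx_adj// pushx_comm.
by rewrite actw !actv actw.
Qed.

Definition word_pile (w : word G) : pile :=
  foldr (fun l P => pile_act (tagged l) P) pile0 w.

Lemma word_pileP w : pile_of (gp_class e w) (word_pile w).
Proof.
elim: w => [|l w IH]; first exact: pile_of1.
by rewrite gp_class_cons; exact: pile_of_act.
Qed.

Lemma word_pile_eq w u : gp_eq e w u -> word_pile w = word_pile u.
Proof.
elim=> {w u} [w u []|//|w u _ -> //|w u t _ -> _ -> //].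
- move=> l r v; rewrite /word_pile !foldr_cat /=; congr foldr.
  exact: (pile_act1 _ (word_pileP r)).
- move=> l r v a b; rewrite /word_pile !foldr_cat /=; congr foldr.
  exact: (pile_actM _ _ (word_pileP r)).
- move=> l r v t a b vt; rewrite /word_pile !foldr_cat /=; congr foldr.
  exact: (pile_act_comm _ _ vt (word_pileP r)).
Qed.

Definition gp_pile (x : GG) : pile := word_pile (generic_quotient.repr x).

Lemma gp_pileP x : pile_of x (gp_pile x).
Proof. by rewrite -{1}(gp_reprK x); exact: word_pileP. Qed.

Lemma gp_pile_in v (a : G v) x : gp_pile (gp_in e a * x) = pile_act a (gp_pile x).
Proof.
rewrite -{1}(gp_reprK x) -(gp_class_cons _ (letter a)) /gp_pile.
by rewrite (word_pile_eq (gp_repr_class _ _)).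
Qed.

Lemma gp_pile1 : gp_pile 1 = pile0.
Proof. exact: (word_pile_eq (gp_repr_class _ _)). Qed.

(** Uniqueness of the normal form: letters act on piles compatibly with the relations, so all
    reduced words of x yield one pile. *)
Lemma pile_of_gp_pile x P : pile_of x P -> P = gp_pile x.
Proof.
elim=> {x P} [|v a x P a1 nP xP IH]; first by rewrite gp_pile1.
by rewrite gp_pile_in -IH /pile_act (negbTE nP) /pushx (negbTE a1).
Qed.

Lemma pile_size_pushx v (a : G v) P : (pile_size (pushx a P) <= (pile_size P).+1)%N.
Proof. by rewrite /pushx; case: ifP => _; rewrite ?pile_size_push. Qed.

Lemma pile_size_act v (a : G v) x :
  (pile_size (gp_pile (gp_in e a * x)%g) <= (pile_size (gp_pile x)).+1)%N.
Proof.
rewrite gp_pile_in; have [c [y [Q [nQ yQ _ ->]]]] := pile_of_split v (gp_pileP x).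
rewrite pile_act_pushx//; apply: (leq_trans (pile_size_pushx _ _)).
by rewrite ltnS /pushx; case: ifP => // _; rewrite pile_size_push.
Qed.

Lemma pile_size_mulr v (a : G v) x :
  (pile_size (gp_pile (x * gp_in e a)%g) <= (pile_size (gp_pile x)).+1)%N.
Proof.
move: (gp_pile x) (gp_pileP x) => P; elim=> {x P} [|w b x P b1 nP xP IH].
  rewrite mul1g -(mulg1 (gp_in e a)); apply: leq_trans (pile_size_act _ _) _.
  by rewrite gp_pile1.
rewrite -mulgA pile_size_push; apply: leq_trans (pile_size_act _ _) _.
by rewrite ltnS.
Qed.

(** * The center of a graph product *)

Hypothesis G_nontrivial : forall v, (1 < #|G v|)%N.
Hypothesis G_abelian : forall v (a b : G v), commute a b.

Lemma exists_nontrivial v : exists a : G v, a != 1.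
Proof.
have /card_gt1P[a [b [_ _ ab]]] := G_nontrivial v.
have [a1|a1] := eqVneq a 1; last by exists a.
by exists b; rewrite -a1 eq_sym.
Qed.

Lemma gp_in_commute v w (a : G v) (b : G w) : w \in st e v ->
  commute (gp_in e a) (gp_in e b).
Proof.
rewrite !inE => /predU1P[wv|]; last exact: gp_in_comm.
by case: _ / (esym wv) b => b; rewrite /commute -!gp_inM G_abelian.
Qed.

(** Let a x be a reduced form of y, with [a] at v, and let [b] be a letter at some w outside st v.
    In b y = y b = a (x b) the letter [a] has to cancel, which makes x b longer than x by more than
    one letter. So v is a cone vertex, [a] is central, and induction applies to x. *)
Lemma gp_center y : (forall x : GG, commute y x) ->
  gp_sub e G [set v | cone_vertex e v]%SET y.
Proof.
have [n] := ubnP (pile_size (gp_pile y)); elim: n y => // n IH y.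
move: (gp_pile y) (gp_pileP y) => P yP.
case: yP (pile_of_gp_pile yP) => [|v a x Q a1 nQ xQ] PE; first by move=> *; exact: (gp_sub_is_subgroup _ _ _).1.
rewrite pile_size_push ltnS => Qn yC.
have vcone : cone_vertex e v.
  apply: contrapT => /negP; rewrite /cone_vertex finset.eqEsubset finset.subsetT /=.
  move=> /fintype.subsetPn[w _]; rewrite !inE negb_or => /andP[wv vw].
  have [b b1] := exists_nontrivial w.
  set z := gp_in e a * x in PE yC.
  have Ey : gp_pile (gp_in e b * z) = push b (push a Q).
    rewrite gp_pile_in -PE /pile_act (negbTE (on_top_push_nadj _ _ _ _))//.
    by rewrite /pushx (negbTE b1).
  have := yC (gp_in e b); rewrite /commute => /esym zb.
  have Ey2 : gp_pile (gp_in e b * z) = pile_act a (gp_pile (x * gp_in e b)).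
    by rewrite zb -mulgA gp_pile_in.
  have xb := pile_size_mulr b x.
  have [c [z' [S [nS zS _ SE]]]] := pile_of_split v (gp_pileP (x * gp_in e b)).
  rewrite {}SE in Ey2 xb.
  rewrite pile_act_pushx// Ey in Ey2.
  (* Without cancellation a letter at v would be on top, but there v is blocked by [b]. *)
  have [ac1|ac1] := eqVneq (a * c) 1; last first.
    have := on_top_push (a * c) S; rewrite /pushx (negbTE ac1) in Ey2.
    rewrite -Ey2 (negbTE (on_top_push_nadj _ _ _ _)) ?(eq_sym v)//.
    by rewrite e_sym.
  rewrite /pushx ac1 eqxx in Ey2.
  have c1 : c != 1 by apply: contra_neq a1 => c1; rewrite c1 mulg1 in ac1.
  rewrite /pushx (negbTE c1) pile_size_push -Ey2 !pile_size_push in xb.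
  by rewrite -(pile_of_gp_pile xQ) !ltnS ltnNge leqnSn in xb.
apply: (is_subgroupM (gp_sub_is_subgroup _ _ _)).
  by apply: gp_sub_in; rewrite inE.
apply: IH; first by rewrite -(pile_of_gp_pile xQ).
have aC z : commute (gp_in e a) z.
  elim/gp_ind: z => [|w b z IHz]; first exact: commute1.
  apply: commuteM => //; apply: gp_in_commute.
  by move: vcone => /eqP ->; rewrite inE.
move=> z; have -> : x = gp_in e a^-1 * (gp_in e a * x).
  by rewrite gp_inV mulKg.
apply/commute_sym/commuteM; last exact/commute_sym/yC.
by rewrite gp_inV; apply/commuteV/commute_sym.
Qed.

End Piles.

(** * Components in a graph without SIL *)

Section Components.
Variables (V : finType) (e : rel V).
Hypotheses (e_sym : symmetric e) (e_irr : irreflexive e).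
Implicit Types (B C D S : {set V}).

Lemma dist_ge2P v w : dist_ge e 2 v w <-> v != w /\ ~~ e v w.
Proof.
split=> [vw|[vw evw] [|u [|? ?]]//=].
- split; first by apply/eqP => wv; have := vw [::] isT wv.
  by apply/negP => evw; have := vw [:: w]; rewrite /= evw => /(_ isT erefl).
- by move=> _ /eqP; rewrite (negbTE vw).
- by rewrite andbT => evu uw; rewrite uw (negbTE evw) in evu.
Qed.

Let erel B := [rel x y | [&& e x y, x \in B & y \in B]].

Let connectC B : connect_sym (erel B).
Proof.
by apply: sym_connect_sym => x y /=; rewrite e_sym; case: (x \in B); rewrite ?andbF ?andbT.
Qed.

Lemma componentE B C x : C \in components e B -> x \in C ->
  C = [set y in B | connect (erel B) x y]%SET.
Proof.
move=> /imsetP[z zB ->]; rewrite inE => /andP[xB zx]; apply/setP => y.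
by rewrite !inE (same_connect (connectC B) zx).
Qed.

Lemma component_sub B C : C \in components e B -> C \subset B.
Proof.
by move=> /imsetP[z _ ->]; apply/fintype.subsetP => y; rewrite inE => /andP[].
Qed.

Lemma component_neq0 B C : C \in components e B -> exists x, x \in C.
Proof. by move=> /imsetP[z zB ->]; exists z; rewrite inE zB connect0. Qed.

Lemma component_ex B x : x \in B -> exists2 C, C \in components e B & x \in C.
Proof.
move=> xB; exists [set y in B | connect (erel B) x y]%SET.
  by apply/imsetP; exists x.
by rewrite inE xB connect0.
Qed.

Lemma component_eq B C D x : C \in components e B -> D \in components e B ->
  x \in C -> x \in D -> C = D.
Proof.
by move=> CB DB xC xD; rewrite (componentE CB xC) (componentE DB xD).
Qed.

Lemma component_closed B C x y : C \in components e B -> x \in C ->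
  e x y -> y \in B -> y \in C.
Proof.
move=> CB xC exy yB; rewrite (componentE CB xC) inE yB connect1//=.
by rewrite exy yB (fintype.subsetP (component_sub CB)).
Qed.

Lemma component_connected B C S x : C \in components e B -> x \in C -> x \in S ->
  (forall y z, y \in C -> y \in S -> z \in C -> e y z -> z \in S) -> C \subset S.
Proof.
move=> CB xC xS SC; apply/fintype.subsetP => y yC.
suff : y \in C :&: S by rewrite inE => /andP[].
have: connect (erel B) x y by move: yC; rewrite (componentE CB xC) inE => /andP[].
move=> /connectP[p]; elim: p x xC xS {yC} => [|z p IH] x xC xS /=.
  by move=> _ ->; rewrite inE xC.
move=> /andP[/and3P[exz _ zB] zp]; have zC := component_closed CB xC exz zB.
by apply: IH => //; exact: (SC x).
Qed.

Lemma component_sub_component B B' C D x : C \in components e B ->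
  D \in components e B' -> C \subset B' -> x \in C -> x \in D -> C \subset D.
Proof.
move=> CB DB' CB' xC xD; apply: (component_connected CB xC xD) => y z _ yD zC eyz.
by apply: (component_closed DB' yD eyz); exact: (fintype.subsetP CB').
Qed.

Lemma component_transfer B B' C : C \in components e B -> C \subset B' ->
  (forall x y, x \in C -> e x y -> y \in B' -> y \in C) -> C \in components e B'.
Proof.
move=> CB CB' CB'closed; have [x xC] := component_neq0 CB.
have [D DB' xD] := component_ex (fintype.subsetP CB' x xC).
suff -> : C = D by [].
apply/eqP; rewrite finset.eqEsubset (component_sub_component CB DB' CB' xC xD) /=.
apply: (component_connected DB' xD xC) => y z _ yC zD eyz.
by apply: CB'closed yC eyz _; exact: (fintype.subsetP (component_sub DB')).
Qed.

Lemma component_image (s : {perm V}) B C : (forall v w, e (s v) (s w) = e v w) ->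
  C \in components e B -> (s @: C)%SET \in components e (s @: B)%SET.
Proof.
move=> se CB; have [x xC] := component_neq0 CB.
have [D DB sxD] : exists2 D, D \in components e (s @: B)%SET & s x \in D.
  by apply/component_ex/imset_f/(fintype.subsetP (component_sub CB)).
suff -> : (s @: C)%SET = D by [].
apply/eqP; rewrite finset.eqEsubset; apply/andP; split.
  rewrite sub_imset_pre; apply: (component_connected CB xC); rewrite ?inE//.
  move=> y z _; rewrite !inE => yD zC eyz; apply: (component_closed DB yD).
    by rewrite se.
  by apply/imset_f/(fintype.subsetP (component_sub CB)).
apply: (component_connected DB sxD); first exact: imset_f.
move=> _ z _ /imsetP[y yC ->] zD; have := fintype.subsetP (component_sub DB) z zD.
move=> /imsetP[t tB ->]; rewrite se => eyt; apply: imset_f.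
exact: (component_closed CB yC).
Qed.

Lemma st_image (s : {perm V}) v : (forall v w, e (s v) (s w) = e v w) ->
  (s @: st e v)%SET = st e (s v).
Proof.
move=> se; apply/setP => w; rewrite -[w](permKV s) mem_imset; last exact: perm_inj.
by rewrite !inE (inj_eq perm_inj) se.
Qed.

Lemma in_co_st v w : (w \in ~: st e v)%SET = (w != v) && ~~ e v w.
Proof. by rewrite !inE negb_or. Qed.

Lemma component_st v C w : C \in components e (~: st e v)%SET -> w \in C ->
  w != v /\ ~~ e v w.
Proof.
move=> Cv wC; have := fintype.subsetP (component_sub Cv) w wC.
by rewrite in_co_st => /andP[].
Qed.

Hypothesis no_SIL : ~ has_SIL e.

(* Without a SIL, a component C of the complement of st v that avoids w must be
   attached to lk v :\: lk w, hence lies on v's side of st w. *)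
Lemma no_SIL_component_sub v w C D : w != v -> ~~ e v w ->
  C \in components e (~: st e v)%SET -> w \notin C ->
  D \in components e (~: st e w)%SET -> v \in D -> C \subset D.
Proof.
move=> wv evw Cv wC Dw vD; set B' := (~: (lk e v :&: lk e w))%SET.
have wv' : w \in (~: st e v)%SET by rewrite in_co_st wv.
have CB' : C \subset B'.
  apply/fintype.subsetP => x /(component_st Cv)[_ evx].
  by rewrite !inE (negbTE evx).
(* Otherwise C would also be a component of [B'], avoiding v and w: a SIL. *)
have : ~ (forall x y, x \in C -> e x y -> y \in B' -> y \in C).
  move=> /(component_transfer Cv CB') CB'c; apply: no_SIL; exists v, w, C.
  split=> //; first by apply/dist_ge2P; rewrite eq_sym.
  by apply/negP => /(component_st Cv)[]; rewrite eqxx.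
move=> /existsNP[x /existsNP[u /not_implyP[xC /not_implyP[exu /not_implyP[uB' /negP uC]]]]].
have [xv evx] := component_st Cv xC.
have evu : e v u.
  apply: contraNT uC => evu; apply: (component_closed Cv xC exu).
  by rewrite in_co_st evu andbT; apply: contraNneq evx => <-; rewrite e_sym.
have ewu : ~~ e w u by move: uB'; rewrite !inE evu.
have uw : u != w by apply: contraNneq evw => <-.
have uD : u \in D by apply: (component_closed Dw vD evu); rewrite in_co_st uw.
(* A neighbour of w in C would pull w, which is outside st v, into C. *)
have Cw : C \subset (~: st e w)%SET.
  apply/fintype.subsetP => y yC; rewrite in_co_st; apply/andP; split.
    by apply: contraNneq wC => <-.
  by apply: contraNN wC => ewy; apply: (component_closed Cv yC); rewrite 1?e_sym.
apply: (component_sub_component Cv Dw Cw xC).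
by apply: (component_closed Dw uD); rewrite 1?e_sym// (fintype.subsetP Cw).
Qed.

End Components.

(** * Partial conjugations *)

Definition gconj (A : groupType) (g x : A) : A := g * x * g^-1.

Section Conjugation.
Variable A : groupType.
Implicit Types g h x y : A.

Lemma gconjMr g : {morph gconj g : x y / x * y}.
Proof. by move=> x y; rewrite /gconj !gnorm. Qed.

Lemma gconjMl g h x : gconj (g * h) x = gconj g (gconj h x).
Proof. by rewrite /gconj !gnorm. Qed.

Lemma gconj1g x : gconj 1 x = x.
Proof. by rewrite /gconj !gnorm. Qed.

Lemma gconj_id g x : commute g x -> gconj g x = x.
Proof. by rewrite /gconj => ->; rewrite mulgK. Qed.

Lemma gconj_commute g x y : commute x y -> commute (gconj g x) (gconj g y).
Proof. by rewrite /commute -!gconjMr => ->. Qed.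

Lemma gconj_morph (B : groupType) (f : A -> B) g x :
  {morph f : x y / x * y} -> f (gconj g x) = gconj (f g) (f x).
Proof. by move=> fM; rewrite /gconj !fM (gmorphV fM). Qed.

End Conjugation.

Section PartialConjugations.
Variables (V : finType) (e : rel V) (G : V -> finGroupType).
Hypotheses (e_sym : symmetric e) (e_irr : irreflexive e).
Hypothesis G_abelian : forall v (a b : G v), commute a b.
Hypothesis no_SIL : ~ has_SIL e.
Local Notation GG := (graph_product e G).
Local Notation TT := (tproduct e G).

Section OneComponent.
Variables (v : V) (C : {set V}).
Hypothesis Cv : C \in components e (~: st e v)%SET.

(** All powers of the partial conjugation at once: the conjugator ranges over [G v], as needed for a
    morphism on a vertex group of the tilde graph. *)
Definition conj_on (a : G v) : GG -> GG :=
  gp_lift (fun w (d : G w) => gconj (gp_in e (if w \in C then a else 1)) (gp_in e d)).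

Let letterM (a : G v) w : {morph
  (fun d : G w => gconj (gp_in e (if w \in C then a else 1)) (gp_in e d)) :
  x y / x * y}.
Proof. by move=> x y; rewrite gp_inM gconjMr. Qed.

Let letterC (a : G v) w u (c : G w) (d : G u) : e w u ->
  commute (gconj (gp_in e (if w \in C then a else 1)) (gp_in e c))
          (gconj (gp_in e (if u \in C then a else 1)) (gp_in e d)).
Proof.
move=> wu; have cd := gp_in_comm c d wu.
(* An edge leaving C ends in st v, whose letters commute with [a]: there conjugation by [a] and by 1
   agree. *)
have st_fix x y (b : G y) : x \in C -> e x y -> y \notin C ->
    gconj (gp_in e (1 : G v)) (gp_in e b) = gconj (gp_in e a) (gp_in e b).
  move=> xC xy yC; rewrite gp_in1 gconj1g gconj_id//.
  apply: gp_in_commute => //; apply: contraNT yC => yv.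
  by apply: (component_closed e_sym Cv xC xy); rewrite inE.
case: ifPn => wC; case: ifPn => uC; try exact: gconj_commute.
  by rewrite (st_fix w)//; exact: gconj_commute.
by rewrite (st_fix u) 1?e_sym//; exact: gconj_commute.
Qed.

Lemma conj_onM a : {morph conj_on a : x y / x * y}.
Proof. by apply: gp_liftM; [exact: letterM|exact: letterC]. Qed.

Lemma conj_on_in a w (d : G w) :
  conj_on a (gp_in e d) = gconj (gp_in e (if w \in C then a else 1)) (gp_in e d).
Proof.
by rewrite /conj_on gp_lift_in//; exact: letterC.
Qed.

Lemma conj_on_comp a b x : conj_on a (conj_on b x) = conj_on (a * b) x.
Proof.
move: x; apply: gp_morph_ext.
- by move=> x y; rewrite !conj_onM.
- exact: conj_onM.
move=> w d; rewrite conj_on_in (gconj_morph _ _ (@conj_onM _)) !conj_on_in.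
(* The inner conjugator [b] is itself fixed by [conj_on a]. *)
have vC : v \notin C by apply/negP => /(component_st Cv)[]; rewrite eqxx.
rewrite (negbTE vC) gp_in1 gconj1g -gconjMl -gp_inM G_abelian.
by case: ifP; rewrite ?mulg1.
Qed.

Lemma conj_on1 x : conj_on 1 x = x.
Proof.
move: x; apply: gp_morph_ext => //; first exact: conj_onM.
by move=> w d; rewrite conj_on_in; case: ifP; rewrite gp_in1 gconj1g.
Qed.

Lemma conj_onK a : cancel (conj_on a) (conj_on a^-1).
Proof. by move=> x; rewrite conj_on_comp mulVg conj_on1. Qed.

Lemma conj_onVK a : cancel (conj_on a^-1) (conj_on a).
Proof. by move=> x; rewrite conj_on_comp mulgV conj_on1. Qed.

Definition conj_aut a := GroupAut (@conj_onM a) (conj_onK a) (conj_onVK a).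

Lemma conj_autM : {morph conj_aut : a b / a * b}.
Proof. by move=> a b; apply: group_autP => x; rewrite /= conj_on_comp. Qed.

End OneComponent.

(** The case w in C and v in D is the excluded one. If only w is in C, then D is contained in C, and
    the conjugator [b] is carried along with D. If neither holds, C and D can meet only when w is in
    st v, where [a] and [b] commute; otherwise D would lie in the component of w. *)
Lemma conj_aut_commute v C w D (Cv : C \in components e (~: st e v)%SET)
    (Dw : D \in components e (~: st e w)%SET) (a : G v) (b : G w) :
  (v == w) ==> (C != D) ->
  ~~ [&& `[< dist_ge e 2 v w >], v \in D & w \in C] ->
  commute (conj_aut Cv a) (conj_aut Dw b).
Proof.
move=> vwCD nadj; apply: group_autP => /=.
apply: gp_morph_ext; try by move=> x y; rewrite !conj_onM.
move=> x d /=; rewrite !conj_on_in// !(gconj_morph _ _ (conj_onM _ _))//.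
rewrite !conj_on_in// -!gconjMl; congr gconj.
have comm : w \in st e v -> commute (gp_in e a) (gp_in e b) by exact: gp_in_commute.
have [wC|wC] := boolP (w \in C); have [vD|vD] := boolP (v \in D).
- have [wv evw] := component_st Cv wC; move: nadj.
  by rewrite vD wC !andbT => /asboolPn[]; apply/dist_ge2P; rewrite 1?eq_sym.
- have [wv evw] := component_st Cv wC.
  have DC : D \subset C.
    by apply: (no_SIL_component_sub e_sym no_SIL _ _ Dw vD Cv wC); rewrite 1?eq_sym 1?e_sym.
  rewrite !gp_in1 gconj1g; case: (boolP (x \in D)) => xD.
    by rewrite (fintype.subsetP DC)// /gconj mulgVK.
  by rewrite gp_in1 mulg1 (gconj_id (commute1 _)) mul1g.
- have [vw ewv] := component_st Dw vD.
  have CD : C \subset D.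
    by apply: (no_SIL_component_sub e_sym no_SIL _ _ Cv wC Dw vD); rewrite 1?eq_sym 1?e_sym.
  rewrite !gp_in1 gconj1g; case: (boolP (x \in C)) => xC.
    by rewrite (fintype.subsetP CD)// /gconj mulgVK.
  by rewrite gp_in1 mulg1 (gconj_id (commute1 _)) mul1g.
- rewrite !gp_in1 !gconj1g.
  case: (boolP (x \in C)) => xC; last by rewrite gp_in1 mulg1 mul1g.
  case: (boolP (x \in D)) => xD; last by rewrite gp_in1 mulg1 mul1g.
  have [wv|wv] := boolP (w \in st e v); first exact/esym/comm.
  have wcv : w \in (~: st e v)%SET by rewrite inE.
  have [C' C'v wC'] := component_ex e wcv; move: wcv.
  rewrite in_co_st => /andP[wNv evw].
  have DC' : D \subset C'.
    by apply: (no_SIL_component_sub e_sym no_SIL _ _ Dw vD C'v); rewrite 1?eq_sym 1?e_sym.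
  move: wC; rewrite (component_eq e_sym Cv C'v xC) ?wC'//.
  exact: (fintype.subsetP DC').
Qed.

Definition pc (p : tvertex e) (a : tgroup e G p) : group_aut GG :=
  conj_aut (valP p) a.

Lemma pcM p : {morph @pc p : a b / a * b}.
Proof. exact: conj_autM. Qed.

Lemma pcC p q (a : tgroup e G p) (b : tgroup e G q) : tedge e p q ->
  commute (pc a) (pc b).
Proof.
move=> /andP[pq]; apply: conj_aut_commute; apply/implyP => /eqP bpq.
apply: contraNneq pq => cpq; apply/eqP/val_inj.
by rewrite [LHS]surjective_pairing [RHS]surjective_pairing; congr pair.
Qed.

Definition phi : TT -> group_aut GG := gp_lift pc.

Lemma phiM : {morph phi : x y / x * y}.
Proof. by apply: gp_liftM; [exact: pcM|exact: pcC]. Qed.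

Lemma phi_in p (a : tgroup e G p) : phi (gp_in (tedge e) a) = pc a.
Proof. by rewrite /phi gp_lift_in//; [exact: pcM|exact: pcC]. Qed.

Lemma pc_in p (a : tgroup e G p) w (d : G w) : pc a (gp_in e d) =
  gconj (gp_in e (if w \in tcomp p then a : G (tbase p) else 1)) (gp_in e d).
Proof. exact: (conj_on_in (valP p)). Qed.

Variable gen : forall v, G v.
Hypothesis G_cyclic : forall v, <[gen v]> = [set: G v]%SET.

Lemma genP v (a : G v) : exists n, a = gen v ^+ n.
Proof.
have : a \in <[gen v]> by rewrite G_cyclic inE.
by move=> /cycleP[n ->]; exists n.
Qed.

Lemma gp_gen_ext (M : groupType) (f g : GG -> M) :
  {morph f : x y / x * y} -> {morph g : x y / x * y} ->
  (forall v, f (gp_gen e gen v) = g (gp_gen e gen v)) -> f =1 g.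
Proof.
move=> fM gM fg; apply: gp_morph_ext => // v a; have [n ->] := genP a.
by rewrite (gmorphX (@gp_inM _ e _ v)) !(gmorphX fM, gmorphX gM); congr (_ ^+ n); exact: fg.
Qed.

Lemma group_aut_gen_ext (a b : group_aut GG) :
  (forall v, a (gp_gen e gen v) = b (gp_gen e gen v)) -> a = b.
Proof.
by move=> ab; apply: group_autP; apply: gp_gen_ext => //; exact: autM.
Qed.

Lemma pc_partial_conj (p : tvertex e) :
  is_partial_conj gen (tbase p) (tcomp p) (pc (gen (tbase p) : tgroup e G p)).
Proof.
by move=> w; rewrite pc_in; case: ifP => // _; rewrite gp_in1 gconj1g.
Qed.

Lemma phi_tgen (p : tvertex e) :
  is_partial_conj gen (tbase p) (tcomp p) (phi (tgen e gen p)).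
Proof. by rewrite phi_in; exact: pc_partial_conj. Qed.

Lemma Aut_pc_is_subgroup : is_subgroup (Aut_pc e gen).
Proof. exact: subgroup_gen_is_subgroup. Qed.

Lemma range_phi : range phi = Aut_pc e gen.
Proof.
apply/seteqP; split=> [_ [x _ <-]|].
  elim/gp_ind: x => [|p a x IH].
    by rewrite (gmorph1 phiM); exact: Aut_pc_is_subgroup.1.
  rewrite phiM phi_in; refine (is_subgroupM Aut_pc_is_subgroup _ IH).
  have [n ->] := genP a; rewrite (gmorphX (@pcM p)).
  refine (is_subgroupX _ Aut_pc_is_subgroup _).
  apply: sub_subgroup_gen; exists (tbase p), (tcomp p); split; first exact: (valP p).
  exact: pc_partial_conj.
apply: subgroup_gen_min.
  split; first by exists 1 => //; exact: (gmorph1 phiM).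
  move=> _ _ [x _ <-] [y _ <-]; exists (x * y^-1) => //.
  by rewrite phiM (gmorphV phiM).
move=> a [v [C [Cv aP]]].
pose p : tvertex e := Sub (v, C) Cv.
exists (tgen e gen p) => //; apply: group_aut_gen_ext => w.
by rewrite phi_tgen; exact/esym/aP.
Qed.

End PartialConjugations.

(** * Injectivity of phi *)

Section ConjugationDetection.
Variables (V : finType) (e : rel V) (G : V -> finGroupType).
Hypothesis e_irr : irreflexive e.
Variables v x : V.
Hypotheses (vNx : v != x) (evx : ~~ e v x) (exv : ~~ e x v).
Local Notation GG := (graph_product e G).

(* Letters at v translate the first coordinate, letters at x translate the
   second one over the fibre of 1 only; in this wreath-like action the
   conjugates of G x by elements with distinct v-exponents are distinct. *)
Let shift w (a : G w) (z : G v * G x) :=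
  (z.1 * vcast v a, if z.1 == 1 then z.2 * vcast x a else z.2).

Let shift_comp w (a b : G w) z : shift b (shift a z) = shift (a * b) z.
Proof.
rewrite /shift /= !vcastM; have [wv|wv] := eqVneq w v; last first.
  rewrite !(vcast_neq (v := v))// !mulg1.
  by case: (z.1 == 1); rewrite // mulgA.
by rewrite !(vcast_neq (v := x)) ?wv// !mulg1 mulgA; case: (z.1 == 1); case: (_ == 1).
Qed.

Let shift1 w z : shift (1 : G w) z = z.
Proof.
have c1 u : vcast u (1 : G w) = 1 by exact: (gmorph1 (@vcastM _ _ u w)).
by rewrite /shift !c1 !mulg1; case: z => ? ? /=; case: ifP.
Qed.

Let shift_inj w (a : G w) : injective (shift a).
Proof. by apply: (can_inj (g := shift a^-1)) => z; rewrite shift_comp mulgV shift1. Qed.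

Let shiftp w (a : G w) := perm (@shift_inj w a).

Let shiftpM w : {morph @shiftp w : a b / a * b}.
Proof. by move=> a b; apply/permP => z; rewrite permM !permE shift_comp. Qed.

Let shiftp1 w (a : G w) : w != v -> w != x -> shiftp a = 1.
Proof.
move=> wv wx; apply/permP => -[h k]; rewrite permE perm1 /shift /=.
by rewrite !vcast_neq// !mulg1; case: ifP.
Qed.

Let shiftpC w u (a : G w) (b : G u) : e w u -> commute (shiftp a) (shiftp b).
Proof.
move=> wu.
have [wvx|] := boolP ((w == v) || (w == x)); last first.
  by rewrite negb_or => /andP[? ?]; rewrite shiftp1//; exact/commute_sym/commute1.
have [uvx|] := boolP ((u == v) || (u == x)); last first.
  by rewrite negb_or => /andP[? ?]; rewrite (shiftp1 b)//; exact/commute1.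
exfalso; move: wu.
by case/orP: wvx => /eqP ->; case/orP: uvx => /eqP ->; rewrite ?e_irr ?(negbTE evx) ?(negbTE exv).
Qed.

Let rho : GG -> {perm (G v * G x)} := gp_lift shiftp.

Let rhoM : {morph rho : x y / x * y}.
Proof. by apply: gp_liftM; [exact: shiftpM|exact: shiftpC]. Qed.

Let rho_in w (a : G w) : rho (gp_in e a) = shiftp a.
Proof. by apply: gp_lift_in; [exact: shiftpM|exact: shiftpC]. Qed.

Let rho1 u z : (rho u z).1 = z.1 * gp_expt v u.
Proof.
elim/gp_ind: u z => [|w a u IH] z.
  by rewrite (gmorph1 rhoM) perm1 (gmorph1 (gp_exptM e_irr v)) mulg1.
rewrite rhoM permM IH rho_in permE /shift /= (gp_exptM e_irr) mulgA.
by congr (_ * _ * _); rewrite /gp_expt gp_lift_in//; [exact: vcastM|exact: vcastC].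
Qed.

Lemma gconj_fix_expt u (c : G x) : c != 1 ->
  gconj u (gp_in e c) = gp_in e c -> gp_expt v u = 1.
Proof.
move=> c1 uc; apply/eqP; apply: contraNT c1 => u1.
have uc' : u * gp_in e c = gp_in e c * u by rewrite -{2}uc /gconj mulgVK.
pose z : G v * G x := (1, 1).
have : rho (u * gp_in e c) z = rho (gp_in e c * u) z by rewrite uc'.
rewrite !rhoM !permM rho_in !permE.
(* Products of permutations act left to right. After [u] the first coordinate is the v-exponent of
   [u]; if it is not 1, the letter [c] acts trivially there, while it moves the starting point (1,
   1). *)
have -> : shift c (rho u z) = rho u z.
  have := rho1 u z; case: (rho u z) => h k /=; rewrite mul1g => ->.
  by rewrite /shift /= (negbTE u1) vcast_neq 1?eq_sym// mulg1.
move=> /perm_inj; rewrite /shift /= eqxx !mul1g vcast_id => -[_ <-].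
exact: eqxx.
Qed.

End ConjugationDetection.

Section Injectivity.
Variables (V : finType) (e : rel V) (G : V -> finGroupType).
Hypotheses (e_sym : symmetric e) (e_irr : irreflexive e).
Hypothesis G_abelian : forall v (a b : G v), commute a b.
Hypothesis G_nontrivial : forall v, (1 < #|G v|)%N.
Hypothesis no_SIL : ~ has_SIL e.
Local Notation GG := (graph_product e G).
Local Notation TT := (tproduct e G).
Local Notation tG := (tgroup e G).
Local Notation phi := (phi e_sym G_abelian).
Local Notation pc := (pc e_sym G_abelian).
Local Notation phiM := (phiM e_sym G_abelian no_SIL).
Local Notation phi_in := (phi_in e_sym G_abelian no_SIL).

Lemma tedge_irr : irreflexive (tedge e).
Proof. by move=> p; rewrite /tedge eqxx. Qed.

Lemma tvertex_eq (p q : tvertex e) : tbase p = tbase q -> tcomp p = tcomp q -> p = q.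
Proof.
move=> bpq cpq; apply: val_inj.
by rewrite [LHS]surjective_pairing [RHS]surjective_pairing; congr pair.
Qed.

Lemma tvertex_eq_in (p q : tvertex e) x : tbase p = tbase q ->
  x \in tcomp p -> x \in tcomp q -> p = q.
Proof.
move=> bpq xp xq; apply: tvertex_eq => //.
apply: (component_eq e_sym (valP p) _ xp xq).
have := valP q; rewrite -/(tbase q) -/(tcomp q) -bpq; exact.
Qed.

Lemma t_commute p q (c : tG p) (d : tG q) : tbase q \notin tcomp p ->
  commute (gp_in (tedge e) c) (gp_in (tedge e) d).
Proof.
move=> qp; have [pq|pq] := eqVneq p q.
  by case: _ / pq d qp => d _; rewrite /commute -!gp_inM (G_abelian c d).
by apply: gp_in_comm; rewrite /tedge pq (negbTE qp) !andbF.
Qed.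

(** Trivial unless p has base point v, so a product over all p effectively runs over the components
    of the complement of st v. *)
Let iota_letter v (a : G v) (p : tvertex e) : TT :=
  gp_in (tedge e) (vcast (tbase p) a : tG p).

Let iota_letter_neq v (a : G v) p : v != tbase p -> iota_letter a p = 1.
Proof. by move=> vp; rewrite /iota_letter vcast_neq// gp_in1. Qed.

Let iota_letter_comm v w (a : G v) (b : G w) p q :
  w \in st e v -> commute (iota_letter a p) (iota_letter b q).
Proof.
move=> vw; have [vp|vp] := eqVneq v (tbase p); last first.
  by rewrite iota_letter_neq//; exact/commute_sym/commute1.
have [wq|wq] := eqVneq w (tbase q); last first.
  by rewrite (iota_letter_neq b)//; exact/commute1.
apply: t_commute; rewrite -wq; apply: contraTN vw => /(component_st (valP p)).
by rewrite -/(tbase p) -vp => -[wv ewv]; rewrite !inE negb_or wv.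
Qed.

(* The inner automorphism by v is the product of the p_(v, C) over all C. *)
Definition iota : GG -> TT :=
  gp_lift (fun v (a : G v) => \prod_(p : tvertex e) iota_letter a p).

Let letterM v : {morph (fun a : G v => \prod_(p : tvertex e) iota_letter a p) :
  a b / a * b}.
Proof.
move=> a b; rewrite -prodgM_commute; last first.
  by move=> p q _ _; apply: iota_letter_comm; rewrite !inE eqxx.
by apply: eq_bigr => p _; rewrite /iota_letter vcastM gp_inM.
Qed.

Let letterC v w (a : G v) (b : G w) : e v w ->
  commute (\prod_(p : tvertex e) iota_letter a p)
          (\prod_(p : tvertex e) iota_letter b p).
Proof.
move=> vw; apply: commute_prod => q _; apply/commute_sym/commute_prod => p _.
by apply/commute_sym/iota_letter_comm; rewrite !inE vw orbT.
Qed.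

Lemma iotaM : {morph iota : x y / x * y}.
Proof. by apply: gp_liftM; [exact: letterM|exact: letterC]. Qed.

Let iota_in v (a : G v) :
  iota (gp_in e a) = \prod_(p : tvertex e) iota_letter a p.
Proof. exact: (gp_lift_in letterM letterC). Qed.

Let iota_rest p (a : tG p) : TT :=
  \prod_(q : tvertex e) (if q == p then 1 else iota_letter (a : G (tbase p)) q).

Let iota_split p (a : tG p) :
  iota (gp_in e (a : G (tbase p))) = gp_in (tedge e) a * iota_rest a.
Proof.
rewrite iota_in; set F := iota_letter _.
have -> : gp_in (tedge e) a = \prod_(q : tvertex e) (if q == p then F q else 1).
  rewrite (prod_seq1 (i := p)) ?index_enum_uniq ?mem_index_enum ?eqxx//.
    by rewrite /F /iota_letter vcast_id.
  by move=> q /negbTE ->.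
rewrite -prodgM_commute.
  by apply: eq_bigr => q _; case: ifP; rewrite ?mulg1 ?mul1g.
move=> q r _ _; case: ifP => _; last exact/commute_sym/commute1.
by case: ifP => _; [exact/commute1|apply: iota_letter_comm; rewrite !inE eqxx].
Qed.

(** Components at one base point are disjoint: the remaining factors belong to components that miss
    [tbase q]. *)
Let iota_rest_comm p (a : tG p) q (c : tG q) : tbase q \in tcomp p ->
  commute (iota_rest a) (gp_in (tedge e) c).
Proof.
move=> qp; apply/commute_sym/commute_prod => r _; apply/commute_sym.
have [rp|rp] := eqVneq r p; first exact/commute_sym/commute1.
have [prb|prb] := eqVneq (tbase p) (tbase r); last first.
  by rewrite iota_letter_neq//; exact/commute_sym/commute1.
apply: t_commute; apply: contraNN rp => qr; apply/eqP.
exact: (tvertex_eq_in (esym prb) qr qp).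
Qed.

(** On a letter at w outside [tcomp p] both sides are trivial conjugations. For w inside,
    conjugation by the letter at p agrees with conjugation by [iota a], since the rest of [iota a]
    commutes with every letter based at w. *)
Lemma pc_iota p (a : tG p) y : gconj (gp_in (tedge e) a) (iota y) = iota (pc a y).
Proof.
move: y; apply: gp_morph_ext.
- by move=> x y; rewrite iotaM gconjMr.
- by move=> x y; rewrite (autM (pc a)) iotaM.
move=> w d; rewrite pc_in//.
have [wp|wp] := boolP (w \in tcomp p); last first.
  rewrite gp_in1 gconj1g gconj_id// iota_in; apply: commute_prod => q _.
  have [wq|wq] := eqVneq w (tbase q); last first.
    by rewrite iota_letter_neq//; exact/commute1.
  by apply: t_commute; rewrite -wq.
rewrite (gconj_morph _ _ iotaM) iota_split gconjMl; congr gconj.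
rewrite gconj_id// iota_in; apply: commute_prod => q _.
have [wq|wq] := eqVneq w (tbase q); last first.
  by rewrite iota_letter_neq//; exact/commute1.
by apply: iota_rest_comm; rewrite -wq.
Qed.

Lemma phi_iota_conj g y : gconj g (iota y) = iota (phi g y).
Proof.
elim/gp_ind: g => [|p a g IH]; first by rewrite (gmorph1 phiM) gconj1g.
by rewrite gconjMl IH phiM phi_in pc_iota.
Qed.

Let aut_prod_fix (I : Type) (r : seq I) (F : I -> group_aut GG) x :
  (forall i, F i x = x) -> (\prod_(i <- r) F i) x = x.
Proof.
move=> Fx; elim: r => [|i r IH]; first by rewrite big_nil.
by rewrite big_cons -[RHS](Fx i) -[in RHS]IH.
Qed.

Lemma phi_iota y x : phi (iota y) x = gconj y x.
Proof.
elim/gp_ind: y x => [|v a y IH] x.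
  by rewrite (gmorph1 iotaM) (gmorph1 phiM) gconj1g.
rewrite iotaM phiM gconjMl -IH; set z := phi _ x.
have -> : (phi (iota (gp_in e a)) * phi (iota y)) x = phi (iota (gp_in e a)) z by [].
move: z; apply: gp_morph_ext; [exact: autM|exact: gconjMr|move=> w d].
(* Of the factors of [iota a] only the one whose component contains w moves a letter at w, and none
   does when w is in st v. *)
have letter_fix q : ~~ [&& v == tbase q & w \in tcomp q] ->
    phi (iota_letter a q) (gp_in e d) = gp_in e d.
  rewrite phi_in pc_in//; have [_|vq] := eqVneq v (tbase q).
    by move=> /= /negbTE ->; rewrite gp_in1 gconj1g.
  by rewrite vcast_neq//; case: ifP; rewrite gp_in1 gconj1g.
have [wv|wv] := boolP (w \in st e v).
  rewrite gconj_id; last exact: gp_in_commute.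
  rewrite iota_in (gmorph_prod phiM) aut_prod_fix// => q; apply: letter_fix.
  apply/negP => /andP[/eqP vq /(component_st (valP q))].
  rewrite -/(tbase q) -vq => -[wNv evw].
  by move: wv; rewrite !inE (negbTE wNv) (negbTE evw).
have [C Cv wC] : exists2 C, C \in components e (~: st e v)%SET & w \in C.
  by apply: component_ex; rewrite inE.
pose p : tvertex e := Sub (v, C) Cv.
have := iota_split (p := p) a; rewrite /= => ->.
rewrite phiM phi_in.
have -> : (pc (a : tG p) * phi (iota_rest (a : tG p))) (gp_in e d) =
  pc (a : tG p) (phi (iota_rest (a : tG p)) (gp_in e d)) by [].
rewrite (gmorph_prod phiM) aut_prod_fix ?pc_in//.
  by rewrite /p /tcomp /= wC.
move=> q; case: eqVneq => [_|qp]; first by rewrite (gmorph1 phiM).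
apply: letter_fix; apply: contraNN qp => /andP[/eqP vq wq].
by apply/eqP/(@tvertex_eq_in q p w).
Qed.

Lemma expt_pc v p (b : tG p) u : gp_expt v (pc b u) = gp_expt v u.
Proof.
move: u; apply: gp_morph_ext.
- by move=> x y; rewrite autM (gp_exptM e_irr).
- exact: gp_exptM.
move=> w d; rewrite pc_in// (gconj_morph _ _ (gp_exptM e_irr v)).
by rewrite gconj_id//; exact: G_abelian.
Qed.

(** Every partial conjugation maps a letter at x to a conjugate and preserves exponents. Only the
    letters at p contribute to the exponent of [u] at [tbase p], as x lies in no other component at
    that base point. *)
Lemma phi_expt p g x : x \in tcomp p -> exists2 u,
  (forall c : G x, phi g (gp_in e c) = gconj u (gp_in e c)) &
  gp_expt (tbase p) u = gp_expt p g :> G (tbase p).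
Proof.
move=> xp; elim/gp_ind: g => [|q b g [u uP uE]].
  exists 1 => [c|]; first by rewrite (gmorph1 phiM) gconj1g.
  by rewrite !(gmorph1 (gp_exptM _ _))//; exact: tedge_irr.
exists (pc b u * gp_in e (if x \in tcomp q then b : G (tbase q) else 1)).
  move=> c; rewrite phiM phi_in.
  have -> : (pc b * phi g) (gp_in e c) = pc b (phi g (gp_in e c)) by [].
  by rewrite uP (gconj_morph _ _ (autM (pc b))) pc_in// -gconjMl.
rewrite (gp_exptM e_irr) expt_pc (gp_exptM tedge_irr) uE.
rewrite [LHS]G_abelian; congr (_ * _).
have [qp|qp] := eqVneq q p.
  by case: _ / (esym qp) b => b; rewrite xp (gp_expt_in tedge_irr) gp_expt_in.
rewrite (gp_expt_neq tedge_irr)//.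
have [xq|xq] := boolP (x \in tcomp q).
  by rewrite gp_expt_neq//; apply: contraNneq qp => bqp; apply/eqP/(tvertex_eq_in bqp xq).
by rewrite gp_in1 (gmorph1 (gp_exptM _ _)).
Qed.

Lemma range_iota_commutator p q (b : tG p) (c : tG q) :
  range iota (gp_in (tedge e) b * gp_in (tedge e) c *
              (gp_in (tedge e) c * gp_in (tedge e) b)^-1).
Proof.
have [qp|qp] := boolP (tbase q \in tcomp p); last first.
  exists 1 => //; rewrite (gmorph1 iotaM) (t_commute b c qp).
  by rewrite mulgV.
pose B := gp_in e (b : G (tbase p)).
(* This is the commutator of [iota B] with the letter [c]; the rest of [iota B] commutes with [c]
   and drops out. *)
exists (B * phi (gp_in (tedge e) c) B^-1) => //.
rewrite iotaM -phi_iota_conj (gmorphV iotaM) (iota_split b).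
set x := gp_in _ b; set y := gp_in _ c; set z := iota_rest b.
have zyz : z * y * z^-1 = y by rewrite (iota_rest_comm b c qp) mulgK.
by rewrite /gconj -{3}zyz !gnorm.
Qed.

Lemma iota_center y : (forall x, gconj y x = x) -> iota y = 1.
Proof.
move=> yC; have : gp_sub e G [set v | cone_vertex e v]%SET y.
  apply: gp_center => // x; have := yC x.
  by rewrite /commute /gconj => {2}<-; rewrite mulgVK.
apply: (gp_sub_min (H := [set y | iota y = 1])).
  split=> [|x1 x2 /= x1E x2E]; first exact: (gmorph1 iotaM).
  by rewrite iotaM (gmorphV iotaM) x1E x2E !gnorm.
move=> v a; rewrite inE => /eqP vcone /=; rewrite iota_in big1// => p _.
rewrite iota_letter_neq//; apply/eqP => vp.
have [x /(fintype.subsetP (component_sub (valP p)))] := component_neq0 (valP p).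
by rewrite -/(tbase p) -vp vcone !inE.
Qed.

Lemma phi_inj : injective phi.
Proof.
suff ker g : phi g = 1 -> g = 1.
  move=> g h gh; apply: (mulIg h^-1); rewrite mulgV; apply: ker.
  by rewrite phiM (gmorphV phiM) gh mulgV.
move=> g1; have : range iota (g * (gp_normal g)^-1).
  apply: (gp_normalP tedge_irr (T := [set: tvertex e]%SET)).
  - split; first by exists 1; rewrite // (gmorph1 iotaM).
    move=> _ _ [x _ <-] [y _ <-]; exists (x * y^-1) => //.
    by rewrite iotaM (gmorphV iotaM).
  - by move=> h _ [y _ <-]; exists (phi h y) => //; rewrite -phi_iota_conj.
  - by move=> p q b c _ _; exact: range_iota_commutator.
  - exact: gp_sub_setT.
have -> : gp_normal g = 1.
  rewrite /gp_normal big1// => p _.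
  have [x xp] := component_neq0 (valP p).
  (* Since [phi g] is trivial, [u] commutes with the letters at x, and x is not in the star of the
     base point of p. *)
  have [u uP <-] := phi_expt g xp.
  have [xv evx] := component_st (valP p) xp.
  have [c c1] := exists_nontrivial G_nontrivial x.
  rewrite (gconj_fix_expt (x := x) _ _ _ _ c1) ?gp_in1//.
  - by rewrite eq_sym.
  - by rewrite e_sym.
  - by rewrite -uP g1.
rewrite invg1 mulg1 => -[y _ yg].
rewrite -yg; apply: iota_center => x.
by rewrite -phi_iota yg g1.
Qed.

End Injectivity.

(** * The action of Sigma *)

Section SemidirectProduct.
Variable A : groupType.
Implicit Types (N K S : set A).

Lemma subgroup_gen_setU S1 S2 (N := subgroup_gen S1) (K := subgroup_gen S2) :
  (forall k n, K k -> N n -> N (gconj k n)) ->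
  subgroup_gen (S1 `|` S2) = [set n * k | n in N & k in K].
Proof.
move=> KN; have sN : is_subgroup N := subgroup_gen_is_subgroup S1.
have sK : is_subgroup K := subgroup_gen_is_subgroup S2.
have sH := subgroup_gen_is_subgroup (S1 `|` S2).
apply/seteqP; split; last first.
  move=> _ [n Nn [k Kk <-]]; refine (is_subgroupM sH _ _).
    by apply: (subgroup_gen_min sH _ Nn) => x ?; apply: sub_subgroup_gen; left.
  by apply: (subgroup_gen_min sH _ Kk) => x ?; apply: sub_subgroup_gen; right.
apply: subgroup_gen_min.
  split; first by exists 1; [exact: sN.1|exists 1; [exact: sK.1|rewrite mulg1]].
  move=> _ _ [n Nn [k Kk <-]] [m Nm [l Kl <-]].
  exists (n * gconj (k * l^-1) m^-1).
    refine (is_subgroupM sN Nn (KN _ _ _ _)); first exact: sK.2.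
    exact: (is_subgroupV sN Nm).
  by exists (k * l^-1); [exact: sK.2|rewrite /gconj !gnorm].
move=> x [S1x|S2x].
  by exists x; [exact: sub_subgroup_gen|exists 1; [exact: sK.1|rewrite mulg1]].
by exists 1; [exact: sN.1|exists x; [exact: sub_subgroup_gen|rewrite mul1g]].
Qed.

End SemidirectProduct.

Section Sigma.
Variables (V : finType) (e : rel V) (G : V -> finGroupType).
Variable gen : forall v, G v.
Hypotheses (e_sym : symmetric e) (e_irr : irreflexive e).
Hypothesis G_abelian : forall v (a b : G v), commute a b.
Hypothesis G_nontrivial : forall v, (1 < #|G v|)%N.
Hypothesis G_cyclic : forall v, <[gen v]> = [set: G v]%SET.
Hypothesis no_SIL : ~ has_SIL e.
Local Notation GG := (graph_product e G).
Local Notation TT := (tproduct e G).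
Local Notation tG := (tgroup e G).
Local Notation phi := (phi e_sym G_abelian).
Local Notation pc := (pc e_sym G_abelian).
Local Notation phiM := (phiM e_sym G_abelian no_SIL).
Local Notation phi_in := (phi_in e_sym G_abelian no_SIL).
Local Notation phi_inj := (@phi_inj V e G e_sym e_irr G_abelian G_nontrivial no_SIL).

Implicit Types (s : {perm V}) (S : {perm tvertex e}) (k : group_aut GG).

(** * Elements of Sigma as permutations of the vertex groups *)

Definition letters (v : V) : set GG := range (@gp_in V e G v).

(** The property shared by graph symmetries and vertex isomorphisms; the clause on [k^-1] makes it
    visibly stable under inverses. *)
Definition permutes_letters s k :=
  [/\ forall v w, e (s v) (s w) = e v w,
      forall v x, letters v x -> letters (s v) (k x) &
      forall v x, letters (s v) x -> letters v ((k^-1 : group_aut GG) x)].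

Lemma permutes_lettersV s k :
  permutes_letters s k -> permutes_letters s^-1 k^-1.
Proof.
move=> [se sk skV]; split=> [v w|v x vx|v x vx].
- by rewrite -[in RHS](permKV s v) -[in RHS](permKV s w) se.
- by apply: skV; rewrite permKV.
- by rewrite invgK -(permKV s v); exact: sk.
Qed.

Lemma permutes_letters1 : permutes_letters 1 1.
Proof. by split=> [v w|v x|v x]; rewrite !perm1// invg1. Qed.

(** The order is reversed because permutations multiply left to right and automorphisms compose as
    functions. *)
Lemma permutes_lettersM s t k l : permutes_letters s k -> permutes_letters t l ->
  permutes_letters (t * s) (k * l).
Proof.
move=> [se sk skV] [te tl tlV]; split=> [v w|v x vx|v x].
- by rewrite !permM se te.
- by rewrite permM; apply: sk; exact: tl.
- by rewrite permM invgM => vx; apply: tlV; exact: skV.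
Qed.

Lemma permutes_letters_is_subgroup :
  is_subgroup [set k | exists s, permutes_letters s k].
Proof.
split; first by exists 1; exact: permutes_letters1.
move=> k l [s sk] [t tl]; exists (t^-1 * s).
by apply: permutes_lettersM => //; exact: permutes_lettersV.
Qed.

Lemma aut_invE (k : group_aut GG) x : (k^-1 : group_aut GG) (k x) = x.
Proof. exact: autK. Qed.

Lemma letters_gen v x : letters v x -> exists n, x = gp_gen e gen v ^+ n.
Proof.
move=> [a _ <-]; have [n ->] := genP G_cyclic a; exists n.
by rewrite (gmorphX (@gp_inM _ e _ v)).
Qed.

Lemma letters_genX v n : letters v (gp_gen e gen v ^+ n).
Proof. by exists (gen v ^+ n); rewrite // (gmorphX (@gp_inM _ e _ v)). Qed.

Lemma Sigma_permutes_letters k : Sigma e gen k -> exists s, permutes_letters s k.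
Proof.
move: k; apply: (subgroup_gen_min permutes_letters_is_subgroup) => k [].
  move=> [s se ks]; exists s; split=> // v x /letters_gen[n ->].
    by rewrite (gmorphX (autM k)) ks; exact: letters_genX.
  by rewrite -ks -(gmorphX (autM k)) aut_invE; exact: letters_genX.
move=> [v [b [kb kid]]]; exists 1; split=> [w u|w x|w x]; rewrite ?perm1//.
  have [-> [c _ <-]|wv] := eqVneq w v; first by rewrite kb; exists (b c).
  by move=> /letters_gen[n ->]; rewrite (gmorphX (autM k)) kid//; exact: letters_genX.
have [-> [c _ <-]|wv] := eqVneq w v.
  by rewrite -[c](autVK b) -kb aut_invE; exists (aut_inv b c).
move=> /letters_gen[n ->]; rewrite -(kid w wv) -(gmorphX (autM k)) aut_invE.
exact: letters_genX.
Qed.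

Definition tpermutes s S :=
  forall p, tbase (S p) = s (tbase p) /\ tcomp (S p) = (s @: tcomp p)%SET.

Lemma tpermutesV s S : tpermutes s S -> tpermutes s^-1 S^-1.
Proof.
move=> sS p; have [b c] := sS ((S^-1)%g p); rewrite permKV in b c; split.
  by rewrite b permK.
by rewrite c -imset_comp -[LHS]imset_id; apply: eq_imset => x /=; rewrite permK.
Qed.

Lemma tpermutes_ex s : (forall v w, e (s v) (s w) = e v w) ->
  exists S, tpermutes s S.
Proof.
move=> se; have stP (p : tvertex e) :
    (s @: tcomp p)%SET \in components e (~: st e (s (tbase p)))%SET.
  have := component_image e_sym se (valP p); rewrite -/(tcomp p) -/(tbase p).
  suff -> : (s @: (~: st e (tbase p)) = ~: st e (s (tbase p)))%SET by [].
  apply/setP => w; rewrite -[w](permKV s) mem_imset; last exact: perm_inj.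
  by rewrite finset.in_setC [RHS]finset.in_setC -st_image// mem_imset//; exact: perm_inj.
pose f (p : tvertex e) : tvertex e := Sub (s (tbase p), (s @: tcomp p)%SET) (stP p).
have fb p : tbase (f p) = s (tbase p) by [].
have fc p : tcomp (f p) = (s @: tcomp p)%SET by [].
have f_inj : injective f.
  move=> p q fpq; apply: tvertex_eq.
    by apply: (@perm_inj _ s); rewrite -!fb fpq.
  by apply: (imset_inj (@perm_inj _ s)); rewrite -!fc fpq.
by exists (perm f_inj) => p; rewrite permE.
Qed.

Lemma tedge_perm s S p q : (forall v w, e (s v) (s w) = e v w) ->
  tpermutes s S -> tedge e (S p) (S q) = tedge e p q.
Proof.
move=> se sS; have [pb pc] := sS p; have [qb qc] := sS q.
rewrite /tedge (inj_eq perm_inj) pb pc qb qc !mem_imset; try exact: perm_inj.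
congr (_ && ~~ (_ && _)); apply: asbool_equiv_eq.
by rewrite !dist_ge2P (inj_eq perm_inj) se.
Qed.

(** Conjugation by [k] transports both the component and the conjugating letter. The letter [a'] is
    kept explicit because faithfulness recovers [k] from it. *)
Lemma permutes_letters_pc s S k p (a : tG p) : permutes_letters s k ->
  tpermutes s S -> exists2 a' : tG (S p),
    k (gp_in e (a : G (tbase p))) = gp_in e (a' : G (tbase (S p))) &
    gconj k (phi (gp_in (tedge e) a)) = phi (gp_in (tedge e) a').
Proof.
move=> sk sS; have [se kL kLV] := sk; have [bS cS] := sS p.
have : letters (tbase (S p)) (k (gp_in e (a : G (tbase p)))).
  by rewrite bS; apply: kL; exists a.
move=> [a' _ ka]; exists a' => //; rewrite !phi_in; apply: group_autP.
apply: gp_morph_ext; try exact: autM.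
move=> w d; rewrite pc_in//.
have -> : gconj k (pc a) (gp_in e d) =
  k (pc a ((k^-1 : group_aut GG) (gp_in e d))) by [].
have : letters ((s^-1)%g w) ((k^-1 : group_aut GG) (gp_in e d)).
  by apply: kLV; rewrite permKV; exists d.
move=> [d' _ kd]; rewrite -kd pc_in// (gconj_morph _ _ (autM k)) kd.
have -> : k ((k^-1 : group_aut GG) (gp_in e d)) = gp_in e d by exact: autVK.
congr gconj; rewrite cS -[w in RHS](permKV s) mem_imset; last exact: perm_inj.
by case: ifP; rewrite ?ka// !gp_in1 (gmorph1 (autM k)).
Qed.

Lemma permutes_letters_sub s S k (T : {set tvertex e}) g :
  permutes_letters s k -> tpermutes s S -> gp_sub (tedge e) tG T g ->
  exists2 g', gp_sub (tedge e) tG (S @: T)%SET g' & gconj k (phi g) = phi g'.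
Proof.
move=> sk sS; move: g; apply: gp_sub_ind.
  exists 1; first exact: (gp_sub_is_subgroup _ _ _).1.
  by rewrite (gmorph1 phiM) /gconj mulg1 mulgV.
move=> p a g pT _ [g' Tg' kg]; have [a' _ ka'] := permutes_letters_pc a sk sS.
exists (gp_in (tedge e) a' * g').
  refine (is_subgroupM (gp_sub_is_subgroup _ _ _) _ Tg').
  by apply: gp_sub_in; exact: imset_f.
by rewrite !phiM gconjMr ka' kg.
Qed.

Lemma Sigma_is_subgroup : is_subgroup (Sigma e gen).
Proof. exact: subgroup_gen_is_subgroup. Qed.

Lemma Sigma_norm k n : Sigma e gen k -> Aut_pc e gen n -> Aut_pc e gen (gconj k n).
Proof.
move=> /Sigma_permutes_letters[s sk]; have [se _ _] := sk.
have [S sS] := tpermutes_ex se.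
rewrite -(range_phi e_sym G_abelian no_SIL G_cyclic) => -[g _ <-].
have [g' _ ->] := permutes_letters_sub sk sS (gp_sub_setT g).
by exists g'.
Qed.

Lemma expt_phi v g x : gp_expt v (phi g x) = gp_expt v x.
Proof.
elim/gp_ind: g x => [|p a g IH] x; first by rewrite (gmorph1 phiM).
rewrite phiM phi_in.
have -> : (pc a * phi g) x = pc a (phi g x) by [].
by rewrite expt_pc.
Qed.

(** Partial conjugations preserve all exponents, elements of Sigma send letters to letters, and a
    letter is determined by its exponents. *)
Lemma Aut_pc_Sigma_trivial k : Aut_pc e gen k -> Sigma e gen k -> k = 1.
Proof.
rewrite -(range_phi e_sym G_abelian no_SIL G_cyclic) => -[g _ <-].
move=> /Sigma_permutes_letters[s [_ sk _]]; apply: group_autP.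
apply: gp_morph_ext => [|//|v a]; first exact: autM.
have := expt_phi v g (gp_in e a); rewrite (gp_expt_in e_irr).
have /sk : letters v (gp_in e a) by exists a.
have [->|vs] := eqVneq (s v) v.
  by move=> [b _ <-]; rewrite (gp_expt_in e_irr) => ->.
move=> [b _ ba]; rewrite -{1}ba gp_expt_neq// => <-.
by rewrite gp_in1 (gmorph1 (autM _)).
Qed.

Lemma Aut_pc_SigmaE :
  Aut_pc_Sigma e gen = [set n * k | n in Aut_pc e gen & k in Sigma e gen].
Proof. apply: subgroup_gen_setU; exact: Sigma_norm. Qed.

Lemma Aut_pc_Sigma_sdprod :
  internal_sdprod (Aut_pc e gen) (Sigma e gen) (Aut_pc_Sigma e gen).
Proof.
split.
- exact: subgroup_gen_is_subgroup.
- exact: subgroup_gen_is_subgroup.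
- exact: Sigma_norm.
- apply/seteqP; split=> [k [nk sk]|_ ->]; first exact: Aut_pc_Sigma_trivial.
  by split; [exact: (subgroup_gen_is_subgroup _).1|exact: Sigma_is_subgroup.1].
- exact: Aut_pc_SigmaE.
Qed.

Lemma Aut_pc_SigmaP a : Aut_pc_Sigma e gen a <->
  exists g k, Sigma e gen k /\ a = phi g * k.
Proof.
rewrite Aut_pc_SigmaE -(range_phi e_sym G_abelian no_SIL G_cyclic).
split=> [[_ [g _ <-] [k sk <-]]|[g [k [sk ->]]]]; first by exists g, k.
by exists (phi g); [exists g|exists k].
Qed.

Lemma Aut_pc_Sigma_is_subgroup : is_subgroup (Aut_pc_Sigma e gen).
Proof. exact: subgroup_gen_is_subgroup. Qed.

Lemma Aut_pc_Sigma_phi g : Aut_pc_Sigma e gen (phi g).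
Proof.
by apply/Aut_pc_SigmaP; exists g, 1; split; [exact: Sigma_is_subgroup.1|rewrite mulg1].
Qed.

(** This makes the relation behind [coset_act] single-valued. *)
Lemma phi_Sigma_inj g h k l : Sigma e gen k -> Sigma e gen l ->
  phi g * k = phi h * l -> g = h.
Proof.
move=> sk sl E; have gh : phi (h^-1 * g) = l * k^-1.
  rewrite phiM (gmorphV phiM); apply: (mulIg k); rewrite -mulgA E.
  by rewrite !gnorm.
apply: (mulgI h^-1); rewrite mulVg; apply: phi_inj.
rewrite (gmorph1 phiM) gh; apply: Aut_pc_Sigma_trivial; last exact: Sigma_is_subgroup.2.
by rewrite -gh -(range_phi e_sym G_abelian no_SIL G_cyclic); exists (h^-1 * g).
Qed.

(* The action of H on H / Sigma, transported along the bijection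
   g |-> phi g Sigma. *)
Definition coset_act (a : group_aut GG) (g : TT) : TT :=
  xget 1 [set g' | exists2 k, Sigma e gen k & a * phi g = phi g' * k].

Local Notation H := (Aut_pc_Sigma e gen).

Lemma coset_actE a g g' k : Sigma e gen k -> a * phi g = phi g' * k ->
  coset_act a g = g'.
Proof.
move=> sk ag; rewrite /coset_act.
set Q := (X in xget _ X).
have [l sl agl] : Q (xget 1 Q) by apply: (xgetPex 1); exists g', k.
by apply: (phi_Sigma_inj sl sk); rewrite -ag -agl.
Qed.

Lemma coset_actP a g : H a ->
  exists2 k, Sigma e gen k & a * phi g = phi (coset_act a g) * k.
Proof.
move=> Ha; have : H (a * phi g).
  exact: (is_subgroupM Aut_pc_Sigma_is_subgroup Ha (Aut_pc_Sigma_phi g)).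
move=> /Aut_pc_SigmaP[g' [k [sk ag]]].
by exists k; rewrite // (coset_actE sk ag).
Qed.

Lemma coset_act1 g : coset_act 1 g = g.
Proof. by apply: (coset_actE Sigma_is_subgroup.1); rewrite mul1g mulg1. Qed.

Lemma coset_actM a b g : H a -> H b ->
  coset_act (a * b) g = coset_act a (coset_act b g).
Proof.
move=> Ha Hb; have [k sk bg] := coset_actP g Hb.
have [l sl al] := coset_actP (coset_act b g) Ha.
apply: (coset_actE (is_subgroupM Sigma_is_subgroup sl sk)).
by rewrite -mulgA bg !mulgA al.
Qed.

Lemma coset_act_phi h g : coset_act (phi h) g = h * g.
Proof. by apply: (coset_actE Sigma_is_subgroup.1); rewrite mulg1 phiM. Qed.

Lemma coset_actK a : H a -> cancel (coset_act a) (coset_act a^-1).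
Proof.
move=> Ha g; rewrite -coset_actM ?mulVg ?coset_act1//.
exact: (is_subgroupV Aut_pc_Sigma_is_subgroup).
Qed.

Lemma coset_actVK a : H a -> cancel (coset_act a^-1) (coset_act a).
Proof.
move=> Ha g; rewrite -coset_actM ?mulgV ?coset_act1//.
exact: (is_subgroupV Aut_pc_Sigma_is_subgroup).
Qed.

Lemma coset_act_Sigma k g g' : Sigma e gen k -> gconj k (phi g) = phi g' ->
  coset_act k g = g'.
Proof. by move=> sk kg; apply: (coset_actE sk); rewrite -kg /gconj mulgVK. Qed.

(** Write a = phi m * k with k in Sigma: the map is left multiplication by m after the automorphism
    of the tilde product that k induces by conjugation, and that automorphism permutes the subgroups
    G_T through S. *)
Lemma coset_act_left_coset a : H a -> exists S : {perm tvertex e},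
  (forall p q, tedge e (S p) (S q) = tedge e p q) /\
  forall g (T : {set tvertex e}),
    coset_act a @` left_coset g (gp_sub (tedge e) tG T) =
    left_coset (coset_act a g) (gp_sub (tedge e) tG (S @: T)%SET).
Proof.
move=> Ha; have /Aut_pc_SigmaP[m [k [sk aE]]] := Ha.
have [s ks] := Sigma_permutes_letters sk; have [se _ _] := ks.
have [S sS] := tpermutes_ex se.
exists S; split=> [p q|g T]; first exact: tedge_perm se sS.
have actE x : coset_act a x = m * coset_act k x.
  have Hk : H k.
    apply/Aut_pc_SigmaP; exists 1, k; split=> //.
    by rewrite (gmorph1 phiM) mul1g.
  by rewrite aE coset_actM ?coset_act_phi//; exact: Aut_pc_Sigma_phi.
have conjk x : gconj k (phi x) = phi (coset_act k x).
  have [x' _ kx] := permutes_letters_sub ks sS (gp_sub_setT x).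
  by rewrite (coset_act_Sigma sk kx).
have act_mul x h : coset_act a (x * h) = coset_act a x * coset_act k h.
  rewrite !actE -mulgA; congr (_ * _); apply: phi_inj.
  by rewrite phiM -!conjk phiM gconjMr.
apply/seteqP; split=> [_ [_ [h Th <-] <-]|_ [h Th <-]].
  exists (coset_act k h); last by rewrite act_mul.
  have [h' Th' kh] := permutes_letters_sub ks sS Th.
  by rewrite (coset_act_Sigma sk kh).
have := permutes_letters_sub (permutes_lettersV ks) (tpermutesV sS) Th.
move=> [h']; rewrite -imset_comp (eq_imset (g := id)) ?imset_id; last first.
  by move=> p /=; rewrite permK.
move=> Th' kh; exists (g * h'); first by exists h'.
rewrite act_mul; congr (_ * _); apply: coset_act_Sigma => //.
by rewrite -kh -gconjMl mulgV gconj1g.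
Qed.

(** An element of Sigma is determined by the letters to which it sends the generators. *)
Lemma finite_Sigma : finite_set (Sigma e gen).
Proof.
pose F (f : {ffun V -> {v : V & G v}}) : group_aut GG :=
  xget 1 [set k : group_aut GG | forall v, k (gp_gen e gen v) = gp_in e (tagged (f v))].
apply: (sub_finite_set (B := range F)); last exact/finite_image/finite_finset.
move=> k /Sigma_permutes_letters[s [_ ks _]].
have /choice[f fP] v : exists l : {v : V & G v},
    k (gp_gen e gen v) = gp_in e (tagged l).
  have /ks[a _ <-] : letters v (gp_gen e gen v) by exists (gen v).
  by exists (letter a).
exists [ffun v => f v] => //; apply: (group_aut_gen_ext G_cyclic) => v.
rewrite fP /F; set Q := (X in xget _ X).
have -> : Q (xget 1 Q) by apply: (xgetPex 1); exists k => u; rewrite ffunE.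
by rewrite ffunE.
Qed.

Lemma finite_coset_act g h : finite_set [set a | H a /\ coset_act a g = h].
Proof.
apply: (sub_finite_set (B := [set phi h * k * (phi g)^-1 | k in Sigma e gen])).
  by move=> a [Ha <-]; have [k sk ag] := coset_actP g Ha; exists k; rewrite // -ag mulgK.
exact/finite_image/finite_Sigma.
Qed.

(** Fixing the identity puts [a] in Sigma. A vertex v that is not a cone vertex carries some p_(v,
    C), and fixing that letter forces the generator of [G v] to be fixed. A cone vertex carries
    none; there uniqueness fixes the vertex, and a group of order 2 has a single nontrivial
    letter. *)
Lemma coset_act_faithful a :
  (forall v, cone_vertex e v -> #|G v| = 2 /\ forall w, cone_vertex e w -> w = v) ->
  H a -> (forall g, coset_act a g = g) -> a = 1.
Proof.
move=> coneP Ha aid; have [k sk] := coset_actP 1 Ha.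
rewrite aid (gmorph1 phiM) mulg1 mul1g => ak; rewrite {}ak {a} in Ha aid *.
have [s ks] := Sigma_permutes_letters sk; have [se kL _] := ks.
have [S sS] := tpermutes_ex se.
apply: (group_aut_gen_ext G_cyclic) => v.
have gen1 : gen v != 1.
  apply/eqP => v1; have := G_nontrivial v; rewrite -cardsT -G_cyclic v1.
  by rewrite cycle1 cards1.
have [vcone|vcone] := boolP (cone_vertex e v).
  have [Gv2 vuniq] := coneP v vcone.
  have sv : s v = v.
    apply: vuniq; rewrite /cone_vertex -st_image//; apply/eqP/setP => w.
    move/eqP: vcone => ->; rewrite -[w](permKV s) mem_imset ?inE//.
    exact: perm_inj.
  have : letters (s v) (k (gp_gen e gen v)) by apply: kL; exists (gen v).
  rewrite sv => -[d _ kd]; rewrite -kd; congr gp_in.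
  have d1 : d != 1.
    apply: contra_neq gen1 => d1; rewrite d1 gp_in1 in kd.
    have /(can_inj (autK k)) : k (gp_gen e gen v) = k 1.
      by rewrite -kd (gmorph1 (autM k)).
    move=> /(congr1 (@gp_expt _ e G v)); rewrite (gp_expt_in e_irr) => ->.
    exact: (gmorph1 (gp_exptM e_irr v)).
  have /setP/(_ d) : [set 1; gen v]%SET = [set: G v]%SET.
    by apply/eqP; rewrite eqEcard finset.subsetT cardsT Gv2 cards2 eq_sym gen1.
  by rewrite !inE (negbTE d1) => /eqP.
have [w] : exists w, w \in (~: st e v)%SET.
  apply/set0Pn; apply: contraNneq vcone => E.
  by rewrite /cone_vertex -[st e v]finset.setCK E finset.setC0.
move=> /(component_ex e)[C Cv wC]; pose p : tvertex e := Sub (v, C) Cv.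
have [a' ka kphi] := permutes_letters_pc (gen v : tG p) ks sS.
have := coset_act_Sigma sk kphi; rewrite aid => /(@gp_in_inj _ _ tG (@tedge_irr _ e) p _ (gen v) _ gen1).
move=> E; rewrite [LHS]ka.
by have /= := congr1 (fun l : {p : tvertex e & tG p} =>
  gp_in e (tagged l : G (tbase (tag l)))) E.
Qed.

End Sigma.

(** * Weights and distances in the complex *)

Section CliqueCosets.
Variables (V : finType) (e : rel V) (G : V -> finGroupType).
Hypothesis e_irr : irreflexive e.
Hypothesis G_abelian : forall v (a b : G v), commute a b.
Hypothesis G_nontrivial : forall v, (1 < #|G v|)%N.
Local Notation GL := (graph_product e G).
Local Notation "g *G S" := (left_coset g (gp_sub e G S))
  (at level 40, format "g  *G  S").
Local Open Scope group_scope.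

Lemma clique_normal (T : {set V}) x : is_complete e T -> gp_sub e G T x ->
  gp_normal x = x.
Proof.
move=> /forall_inP cT Tx; apply/esym/divg1_eq.
apply: (gp_normalP e_irr (T := T) (N := [set 1])) => //.
- by split=> // _ _ -> ->; rewrite /= invg1 mulg1.
- by move=> g _ ->; rewrite mulg1 mulgV.
move=> v w a b vT wT /=; suff -> : commute (gp_in e a) (gp_in e b) by rewrite mulgV.
apply: gp_in_commute => //; rewrite !inE; have [//|vw] := eqVneq w v.
by have /forall_inP/(_ w wT) := cT v vT; rewrite eq_sym vw.
Qed.

Lemma finite_clique (T : {set V}) : is_complete e T -> finite_set (gp_sub e G T).
Proof.
move=> cT; pose F (f : {dffun forall v : V, G v}) : GL := \prod_(v : V) gp_in e (f v).
apply: (sub_finite_set (B := range F)); last exact/finite_image/finite_finset.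
move=> x Tx; exists [ffun v => gp_expt v x] => //.
rewrite -[RHS](clique_normal cT Tx); by apply: eq_bigr => v _; rewrite ffunE.
Qed.

Lemma clique_sub (S T : {set V}) x : is_complete e T -> gp_sub e G T x ->
  (forall v, v \notin S -> gp_expt v x = 1) -> gp_sub e G S x.
Proof.
move=> cT Tx Sx; rewrite -(clique_normal cT Tx) /gp_normal.
elim/big_ind: _ => [|y z|v _]; first exact: (gp_sub_is_subgroup _ _ _).1.
  exact: (is_subgroupM (gp_sub_is_subgroup _ _ _)).
have [vS|vS] := boolP (v \in S); first exact: gp_sub_in.
by rewrite Sx// gp_in1; exact: (gp_sub_is_subgroup _ _ _).1.
Qed.

Lemma gp_coset_subset g h (S T : {set V}) : g *G S `<=` h *G T -> S \subset T.
Proof.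
move=> sgh; have sT := gp_sub_is_subgroup e G T.
have hg : gp_sub e G T (h^-1 * g).
  by apply/left_cosetE/sgh/left_coset_refl; exact: gp_sub_is_subgroup.
apply/fintype.subsetP => v vS; apply: contrapT => /negP vT.
have [a a1] := exists_nontrivial G_nontrivial v.
have : (h *G T) (g * gp_in e a) by apply: sgh; exists (gp_in e a) => //; exact: gp_sub_in.
rewrite left_cosetE => hga.
have : gp_sub e G T (gp_in e a).
  have -> : gp_in e a = (h^-1 * g)^-1 * (h^-1 * (g * gp_in e a)) by rewrite !gnorm.
  exact: (is_subgroupM sT (is_subgroupV sT hg) hga).
by move=> /(gp_sub_expt e_irr vT); rewrite (gp_expt_in e_irr) => /eqP; rewrite (negbTE a1).
Qed.

Lemma gp_coset_inj g h (S T : {set V}) : g *G S = h *G T -> S = T.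
Proof.
move=> gh; apply/eqP; rewrite finset.eqEsubset.
by apply/andP; split; [apply: (@gp_coset_subset g h)|apply: (@gp_coset_subset h g)];
  rewrite gh.
Qed.

Lemma gp_coset_refl g (S : {set V}) : (g *G S) g.
Proof. by apply: left_coset_refl; exact: gp_sub_is_subgroup. Qed.

Lemma gp_coset_eq g h (S : {set V}) : (g *G S) h -> g *G S = h *G S.
Proof. by apply: left_coset_eq; exact: gp_sub_is_subgroup. Qed.

Lemma complete_gp_coset g T : complete_coset (g *G T) -> is_complete e T.
Proof. by move=> [h [S [cS /gp_coset_inj ->]]]. Qed.

Lemma complete_coset_in (A : set GL) g : complete_coset A -> A g ->
  exists2 T, is_complete e T & A = g *G T.
Proof. by move=> [h [T [cT ->]]] /gp_coset_eq ->; exists T. Qed.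

Definition star (g : GL) : set GL :=
  \bigcup_(T in [set T : {set V} | is_complete e T]) (g *G T).

Lemma finite_star g : finite_set (star g).
Proof.
apply: bigcup_finite => [|T cT]; first exact: finite_finset.
exact/finite_image/finite_clique.
Qed.

End CliqueCosets.

Section Complex.
Import Order.TTheory GRing.Theory Num.Theory.
Import numFieldNormedType.Exports.
Variables (R : realType) (V : finType) (e : rel V) (G : V -> finGroupType).
Hypothesis e_irr : irreflexive e.
Hypothesis G_abelian : forall v (a b : G v), commute a b.
Hypothesis G_nontrivial : forall v, (1 < #|G v|)%N.
Local Notation GL := (graph_product e G).
Local Notation X := (complex R e G).
Local Notation "g *G S" := (left_coset g (gp_sub e G S))
  (at level 40, format "g  *G  S").
Local Open Scope ring_scope.
Implicit Types (x y z : X) (g h : GL) (S T : {set V}).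

Lemma complexP x y : (forall A, x A = y A) -> x = y.
Proof.
move: x y => [w w1 w2 w3 w4 w5] [w' w1' w2' w3' w4' w5'] /= /funext ww'.
move: w1 w2 w3 w4 w5 w1' w2' w3' w4' w5'; rewrite ww' => *.
by congr Complex; exact: Prop_irrelevance.
Qed.

Lemma wt_sum_inj (I : finType) (F : I -> set GL) x : injective F ->
  (forall A, x A != 0 -> exists i, A = F i) -> \sum_i x (F i) = 1.
Proof.
move=> F_inj xF; rewrite -(wt_sum x) (fsbigE [seq F i | i <- index_enum I]).
- by rewrite big_map; apply: eq_bigl => i; rewrite in_setT.
- by rewrite map_inj_uniq// index_enum_uniq.
- by [].
move=> A _; apply: contraNeq => /xF[i ->]; apply: map_f; exact: mem_index_enum.
Qed.

Lemma wt_neq0_ex x : exists A, x A != 0.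
Proof.
apply: contrapT => /forallNP x0; have := wt_sum x.
rewrite fsbig1 => [/eqP|A _]; first by rewrite eq_sym oner_eq0.
by have /negP := x0 A; rewrite negbK => /eqP.
Qed.

Section InCube.
Variables (g : GL) (T1 T2 : {set V}) (x : X).
Hypothesis xc : in_cube g T1 T2 x.

Lemma in_cube_sum : \sum_(S : {set V}) x (g *G S) = 1.
Proof.
apply: wt_sum_inj => [S T /(gp_coset_inj e_irr G_nontrivial)//|A /xc[S [_ _ ->]]].
by exists S.
Qed.

Lemma in_cube_subset S : x (g *G S) != 0 -> T1 \subset S /\ S \subset T2.
Proof. by move=> /xc[T [? ? /(gp_coset_inj e_irr G_nontrivial) ->]]. Qed.

Lemma cube_coordE v : cube_coord g T1 T2 x v = \sum_(S : {set V} | v \in S) x (g *G S).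
Proof.
rewrite /cube_coord [LHS]big_mkcond [RHS]big_mkcond; apply: eq_bigr => S _.
have [->|/in_cube_subset[-> ->]//] := eqVneq (x (g *G S)) 0.
by case: ifP; case: ifP.
Qed.

Lemma in_cube_coset h S : x (h *G S) != 0 -> (g *G S) h /\ h *G S = g *G S.
Proof.
move=> /xc[T [_ _ hg]]; have := hg.
move=> /(gp_coset_inj e_irr G_nontrivial) ST; rewrite -ST in hg.
by split=> //; rewrite -hg; exact: gp_coset_refl.
Qed.

End InCube.

(* The total barycentric weight of the cosets containing h. *)
Definition mass h x : R := \sum_(S : {set V}) x (h *G S).

Lemma cube_dist_coord g T1 T2 x y v : v \in (T2 :\: T1)%SET ->
  cube_coord g T1 T2 x v <= cube_coord g T1 T2 y v + cube_dist g T1 T2 x y.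
Proof.
move=> vT; rewrite -lerBlDl; apply: (le_trans (ler_norm _)).
rewrite -sqrtr_sqr; apply: ler_wsqrtr; rewrite (bigD1 v)//= lerDl.
by apply: sumr_ge0 => w _; exact: sqr_ge0.
Qed.

(* On a cube, [mass h] is a minimum of coordinates (or constant). *)
Lemma mass_cube h g T1 T2 x y : is_complete e T2 ->
  in_cube g T1 T2 x -> in_cube g T1 T2 y ->
  mass h x <= mass h y + cube_dist g T1 T2 x y.
Proof.
move=> cT2 xc yc.
have dist0 : 0 <= cube_dist g T1 T2 x y by exact: sqrtr_ge0.
(* If every coset in the support of y contains h, then [mass h y] is 1. Otherwise a largest coset
   missing h singles out the coordinate v to compare. *)
pose bad S := (y (g *G S) != 0) && ~~ `[< (g *G S) h >].
have [/existsP[S0 badS0]|/existsPn nobad] := boolP [exists S, bad S]; last first.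
  apply: (@le_trans _ _ 1).
    rewrite -(in_cube_sum xc); apply: ler_sum => S _.
    have [->|xS] := eqVneq (x (h *G S)) 0; first exact: wt_ge0.
    by have [_ ->] := in_cube_coset xc xS.
  rewrite -[leLHS]addr0 lerD// -(in_cube_sum yc); apply: ler_sum => S _.
  have [->|yS] := eqVneq (y (g *G S)) 0; first exact: wt_ge0.
  by have := nobad S; rewrite negb_and yS negbK => /asboolP/gp_coset_eq ->.
have [S /andP[yS /asboolPn hS] Smax] := arg_maxnP (fun S : {set V} => #|S|) badS0.
have [T1S ST2] := in_cube_subset yc yS.
(* By the chain condition such a coset would be strictly larger than that of S, so maximality forces
   it to contain h. *)
have above S' v : v \in S' -> v \notin S -> y (g *G S') != 0 -> (g *G S') h.
  move=> vS' vS yS'; apply: contrapT => hS'.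
  have badS' : bad S' by rewrite /bad yS'; apply/asboolPn.
  have [SS'|S'S] := wt_chain yS yS'.
    have /eqP SE : S == S'.
      rewrite eqEcard (gp_coset_subset e_irr G_nontrivial SS').
      exact: Smax.
    by rewrite SE vS' in vS.
  by have := fintype.subsetP (gp_coset_subset e_irr G_nontrivial S'S) v vS'; rewrite (negbTE vS).
have [hT2|hT2] := pselect ((g *G T2) h); last first.
  rewrite /mass [leLHS]big1; first by rewrite addr_ge0// sumr_ge0// => S' _; exact: wt_ge0.
  move=> S' _; apply: contrapT => /eqP xS'; have [hS' SE] := in_cube_coset xc xS'.
  rewrite SE in xS'; have [_ S'T2] := in_cube_subset xc xS'.
  by apply: hT2; move: hS'; rewrite !left_cosetE; exact: gp_subS.
set u := (g^-1 * h)%g.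
have uT2 : gp_sub e G T2 u by rewrite -left_cosetE.
have [v vS uv] : exists2 v, v \notin S & gp_expt v u != 1%g.
  apply: contrapT => noex; apply: hS; rewrite left_cosetE -/u.
  apply: (clique_sub e_irr G_abelian cT2 uT2) => v vS.
  by apply: contrapT => /eqP uv; apply: noex; exists v.
have inS' S' : (g *G S') h -> v \in S'.
  rewrite left_cosetE -/u => S'u; apply: contraNT uv => vS'.
  exact/eqP/(gp_sub_expt e_irr vS' S'u).
have vT : v \in (T2 :\: T1)%SET.
  rewrite finset.in_setD (inS' _ hT2) andbT; apply: contraNN vS; exact: (fintype.subsetP T1S).
(* Every coset of the cube through h involves v, so the v-coordinate bounds [mass h x] from above;
   at y it is at most [mass h y], by [above]. *)
apply: (@le_trans _ _ (cube_coord g T1 T2 x v)).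
  rewrite (cube_coordE xc) [leRHS]big_mkcond; apply: ler_sum => S' _.
  have [->|xS'] := eqVneq (x (h *G S')) 0; first by case: ifP => // _; exact: wt_ge0.
  by have [hS' ->] := in_cube_coset xc xS'; rewrite inS'.
apply: (le_trans (@cube_dist_coord g T1 T2 x y v vT)); rewrite lerD2r.
rewrite (cube_coordE yc) big_mkcond; apply: ler_sum => S' _.
case: ifP => [vS'|_]; last exact: wt_ge0.
have [->|yS'] := eqVneq (y (g *G S')) 0; first exact: wt_ge0.
by have /gp_coset_eq -> := above _ _ vS' vS yS'.
Qed.

Lemma mass_path h x y l : path_length x y l -> mass h x <= mass h y + l.
Proof.
elim=> {x y l} [x|g T1 T2 x y z l cT _ xc yc _ IH]; first by rewrite addr0.
by apply: (le_trans (mass_cube h cT xc yc)); rewrite [leRHS]addrCA [leLHS]addrC lerD2l.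
Qed.

Lemma mass_ball h x y r : complex_ball x r y -> mass h x < mass h y + r.
Proof.
move=> /complex_ballP[l /mass_path xyl lr].
by apply: le_lt_trans (xyl h) _; rewrite ltrD2l.
Qed.

Lemma mass_gt0_ex x : exists h, 0 < mass h x.
Proof.
have [A xA] := wt_neq0_ex x; have [g [T [_ AE]]] := wt_coset xA.
exists g; rewrite /mass (bigD1 T)//= ltr_pwDl//.
  by rewrite lt_neqAle eq_sym -AE xA wt_ge0.
by apply: sumr_ge0 => S _; exact: wt_ge0.
Qed.

Lemma mass_gt0 h x : 0 < mass h x -> exists2 T, is_complete e T & x (h *G T) != 0.
Proof.
move=> hx; have := lt0r_neq0 hx => /eqP/psumr_neq0P[S _|S /= xS]; first exact: wt_ge0.
have xS0 := lt0r_neq0 xS; exists S => //.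
exact: (complete_gp_coset e_irr G_nontrivial (wt_coset xS0)).
Qed.

(** The support is a finite nonempty chain, so it has a smallest coset. *)
Lemma wt_common x : exists h, forall A, x A != 0 -> A h.
Proof.
suff h (s : seq (set GL)) : (forall A, A \in s -> x A != 0) ->
    exists h, forall A, A \in s -> A h.
  have /finite_seqP[s sE] := wt_finite x.
  have /h[g gP] A : A \in s -> x A != 0.
    by move=> As; suff : [set` s] A by rewrite -sE.
  by exists g => A xA; apply: gP; have : [set A | x A != 0] A by []; rewrite sE.
move=> sx; suff [B xB Bs] : exists2 B, x B != 0 & forall A, A \in s -> B `<=` A.
  have [g [T [_ BE]]] := wt_coset xB; exists g => A /Bs; apply.
  by rewrite BE; exact: gp_coset_refl.
elim: s sx => [|A s IH] sx; first by have [B xB] := wt_neq0_ex x; exists B.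
have [|B xB Bs] := IH; first by move=> B Bs; apply: sx; rewrite inE Bs orbT.
have xA : x A != 0 by apply: sx; rewrite inE eqxx.
have [AB|BA] := wt_chain xA xB.
  exists A => // C; rewrite inE => /predU1P[->//|/Bs]; exact: subset_trans.
by exists B => // C; rewrite inE => /predU1P[->//|/Bs].
Qed.

(** * Transport of points along a bijection that permutes cosets *)

Section Transport.
Variables (f f' : GL -> GL) (s : {perm V}).
Hypotheses (fK : cancel f f') (f'K : cancel f' f).
Hypothesis se : forall v w, e (s v) (s w) = e v w.
Hypothesis f_coset : forall g T, f @` (g *G T) = f g *G (s @: T)%SET.

Lemma image_preimageK A : f @` (f @^-1` A) = A.
Proof.
by apply/seteqP; split=> [_ [g Ag <-]//|g Ag]; exists (f' g); rewrite /preimage /= f'K.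
Qed.

Lemma preimage_imageK A : f @^-1` (f @` A) = A.
Proof.
apply/seteqP; split=> [g [h Ah /(can_inj fK) <-]//|g Ag]; by exists g.
Qed.

Lemma is_complete_perm T : is_complete e (s @: T)%SET = is_complete e T.
Proof.
apply/forall_inP/forall_inP => cT v vT; apply/forall_inP => w wT; last first.
  move: vT wT => /imsetP[v' vT ->] /imsetP[w' wT ->].
  by rewrite se (inj_eq perm_inj); have /forall_inP/(_ w' wT) := cT v' vT.
have /forall_inP/(_ (s w) (imset_f _ wT)) := cT (s v) (imset_f _ vT).
by rewrite se (inj_eq perm_inj).
Qed.

Variable x : X.
Let wt' A := x (f @^-1` A).

Let wt'_ge0 A : 0 <= wt' A. Proof. exact: wt_ge0. Qed.

Let wt'_coset A : wt' A != 0 -> complete_coset A.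
Proof.
move=> /wt_coset[g [T [cT AE]]]; exists (f g), (s @: T)%SET.
by rewrite is_complete_perm cT -f_coset -AE image_preimageK.
Qed.

Let wt'_chain A B : wt' A != 0 -> wt' B != 0 -> A `<=` B \/ B `<=` A.
Proof.
move=> xA xB; have [AB|BA] := wt_chain xA xB; [left|right].
  by rewrite -(image_preimageK A) -(image_preimageK B); exact: image_subset.
by rewrite -(image_preimageK A) -(image_preimageK B); exact: image_subset.
Qed.

Let wt'_finite : finite_set [set A | wt' A != 0].
Proof.
apply: (sub_finite_set (B := [set f @` A | A in [set A | x A != 0]])).
  by move=> A /= xA; exists (f @^-1` A); rewrite ?image_preimageK.
exact/finite_image/wt_finite.
Qed.

Let wt'_sum : \sum_(A \in [set: set GL]) wt' A = 1.
Proof.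
rewrite -(wt_sum x); apply/esym.
apply: (reindex_fsbig (fun A => f @^-1` A)); split=> //.
- move=> A B _ _ AB; rewrite -(image_preimageK A) -(image_preimageK B).
  by rewrite AB.
- by move=> A _; exists (f @` A); rewrite ?preimage_imageK.
Qed.

Definition transport : X :=
  Complex wt'_ge0 wt'_coset wt'_chain wt'_finite wt'_sum.

End Transport.

Section TransportIsometry.
Variables (f f' : GL -> GL) (s : {perm V}).
Hypotheses (fK : cancel f f') (f'K : cancel f' f).
Hypothesis se : forall v w, e (s v) (s w) = e v w.
Hypothesis f_coset : forall g T, f @` (g *G T) = f g *G (s @: T)%SET.
(** Specified by its weights only, because [complex_act] is obtained by choice and known through
    [complex_actE]. *)
Variable tr : X -> X.
Hypothesis trE : forall x A, tr x A = x (f @^-1` A).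

Let tr_image x A : tr x (f @` A) = x A.
Proof. by rewrite trE (preimage_imageK fK). Qed.

Let imset_perm_subset S T : (s @: S \subset s @: T)%SET = (S \subset T).
Proof.
apply/idP/idP => [/fintype.subsetP sST|]; last exact: imsetS.
by apply/fintype.subsetP => v vS; have := sST _ (imset_f s vS); rewrite mem_imset//; exact: perm_inj.
Qed.

Lemma transport_in_cube g T1 T2 x : in_cube g T1 T2 x ->
  in_cube (f g) (s @: T1)%SET (s @: T2)%SET (tr x).
Proof.
move=> xc A; rewrite trE => /xc[S [T1S ST2 AE]]; exists (s @: S)%SET.
by rewrite !imset_perm_subset; split=> //; rewrite -f_coset -AE (image_preimageK f'K).
Qed.

Lemma transport_cube_coord g T1 T2 x v :
  cube_coord (f g) (s @: T1)%SET (s @: T2)%SET (tr x) (s v) =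
  cube_coord g T1 T2 x v.
Proof.
rewrite /cube_coord (reindex_inj (imset_inj (@perm_inj _ s))) /=.
apply: eq_big => S; first by rewrite !imset_perm_subset mem_imset//; exact: perm_inj.
by move=> _; rewrite -f_coset tr_image.
Qed.

Lemma transport_cube_dist g T1 T2 x y :
  cube_dist (f g) (s @: T1)%SET (s @: T2)%SET (tr x) (tr y) =
  cube_dist g T1 T2 x y.
Proof.
rewrite /cube_dist (reindex_inj (@perm_inj _ s)) /=; congr Num.sqrt.
apply: eq_big => v; first by rewrite !inE !mem_imset//; exact: perm_inj.
by move=> _; rewrite !transport_cube_coord.
Qed.

Lemma transport_path_length x y l : path_length x y l ->
  path_length (tr x) (tr y) l.
Proof.
elim=> {x y l} [x|g T1 T2 x y z l cT T12 xc yc _ IH]; first exact: path_length0.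
rewrite -transport_cube_dist; apply: path_lengthS => //.
- by rewrite is_complete_perm.
- by rewrite imset_perm_subset.
- exact: transport_in_cube.
- exact: transport_in_cube.
Qed.

Lemma transport_complex_dist x y : (complex_dist (tr x) (tr y) <= complex_dist x y)%E.
Proof.
by apply: ereal_inf_le_tmp => _ [l xyl <-]; exists l => //; exact: transport_path_length.
Qed.

End TransportIsometry.

Lemma sqrt_sum_le (I : finType) (P : pred I) (F : I -> R) (d : R) : 0 <= d ->
  (forall i, P i -> `|F i| <= d) ->
  Num.sqrt (\sum_(i | P i) F i ^+ 2) <= d *+ #|I|.
Proof.
move=> d0 Fd; have -> : d *+ #|I| = Num.sqrt ((d *+ #|I|) ^+ 2).
  by rewrite sqrtr_sqr ger0_norm// mulrn_wge0.
apply: ler_wsqrtr; apply: (@le_trans _ _ (\sum_(i : I) d ^+ 2)).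
  rewrite big_mkcond; apply: ler_sum => i _; case: ifP => [Pi|_]; last exact: sqr_ge0.
  by rewrite -real_normK ?num_real// ler_sqr ?nnegrE// Fd.
rewrite sumr_const exprMn_n -[leLHS]mulr_natr -[leRHS]mulr_natr.
rewrite ler_wpM2l ?sqr_ge0// ler_nat.
by case: #|I| => // n; rewrite expnS expn1 leq_pmulr.
Qed.

(** The union of the cubes from G_0 to G_T with T a clique, where G_0 is the trivial subgroup; its
    translates by the tilde product cover the complex. *)
Definition fundamental_domain : set X :=
  [set x | forall A, x A != 0 -> exists2 T, is_complete e T & A = 1%g *G T].

Local Notation K := fundamental_domain.

Lemma fundamental_sum x : K x -> \sum_(T : {set V}) x (1%g *G T) = 1.
Proof.
move=> Kx; apply: wt_sum_inj => [S T /(gp_coset_inj e_irr G_nontrivial)//|A].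
by move=> /Kx[T _ ->]; exists T.
Qed.

(** As the support of y lies in that of x, one cube contains both and a single segment suffices.
    Each coordinate is a sum of at most [#|{set V}|] weights, and [sqrt_sum_le] adds the factor
    [#|V|]. *)
Lemma fundamental_dist x y (d : R) : K x ->
  (forall T, y (1%g *G T) != 0 -> x (1%g *G T) != 0) -> K y ->
  0 <= d -> (forall T, `|x (1%g *G T) - y (1%g *G T)| <= d) ->
  exists2 l, path_length y x l & l <= d *+ #|{set V}| *+ #|V|.
Proof.
move=> Kx xy Ky d0 dxy.
(* The largest member of the support, written as a union. *)
pose T2 := (\bigcup_(T : {set V} | x (1%g *G T) != 0) T)%SET.
have cT2 : is_complete e T2.
  apply/forall_inP => v /bigcupP[S xS vS]; apply/forall_inP => w /bigcupP[T xT wT].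
  have complete_of U : x (1%g *G U) != 0 -> is_complete e U.
    by move=> /wt_coset/(complete_gp_coset e_irr G_nontrivial).
  have [ST|TS] := wt_chain xS xT.
    have vT := fintype.subsetP (gp_coset_subset e_irr G_nontrivial ST) v vS.
    by have /forall_inP/(_ v vT)/forall_inP/(_ w wT) := complete_of _ xT.
  have wS := fintype.subsetP (gp_coset_subset e_irr G_nontrivial TS) w wT.
  by have /forall_inP/(_ v vS)/forall_inP/(_ w wS) := complete_of _ xS.
have xc : in_cube 1%g finset.set0 T2 x.
  move=> A xA; have [T cT AE] := Kx A xA; exists T; split=> //.
    exact: finset.sub0set.
  by apply: (finset.bigcup_sup T) => //; rewrite -AE.
have yc : in_cube 1%g finset.set0 T2 y.
  move=> A yA; have [T cT AE] := Ky A yA; exists T; split=> //.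
    exact: finset.sub0set.
  by apply: (finset.bigcup_sup T) => //; apply: xy; rewrite -AE.
exists (cube_dist 1%g finset.set0 T2 y x).
  rewrite -[cube_dist _ _ _ _ _]addr0; apply: path_lengthS => //.
    exact: finset.sub0set.
  exact: path_length0.
apply: sqrt_sum_le => [|v _]; first exact: mulrn_wge0.
rewrite (cube_coordE xc) (cube_coordE yc) -sumrB.
apply: (le_trans (ler_norm_sum _ _ _)).
apply: (@le_trans _ _ (\sum_(S : {set V}) d)); last by rewrite sumr_const.
rewrite big_mkcond; apply: ler_sum => S _; case: ifP => // _.
by rewrite distrC.
Qed.

Lemma ultra_cvg (Y : Type) (F : set_system Y) (w : Y -> R) : UltraFilter F ->
  F [set y | 0 <= w y <= 1] ->
  exists l, forall d, 0 < d -> F [set y | `|w y - l| < d].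
Proof.
move=> UF F01; have G01 : F (w @^-1` `[0, 1]).
  by apply: filterS F01 => y /=; rewrite in_itv.
have [l [_ lF]] := @segment_compact R 0 1 (w @ F) _ G01.
exists l => d d0; have [//|Fn] := in_ultra_setVsetC [set y | `|w y - l| < d] UF.
have wFn : (w @ F) [set r | ~ `|r - l| < d] by exact: Fn.
have nl : nbhs l [set r | `|r - l| < d].
  by apply/nbhs_ballP; exists d => // r; rewrite /ball /= distrC.
by have [r [/= nr r1]] := lF _ _ wFn nl.
Qed.

(** Along an ultrafilter the finitely many weights converge. A positive limit weight is already
    positive nearby, so the limit support is again a chain of cliques, contained in the supports of
    nearby points, as [fundamental_dist] demands; it may be strictly smaller. *)
Lemma compact_fundamental_domain : compact K.
Proof.
rewrite compact_ultra /= => F UF FK.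
have wt01 x T : K x -> 0 <= x (1%g *G T) <= 1.
  move=> Kx; rewrite wt_ge0 /= -(fundamental_sum Kx) (bigD1 T)//= lerDl.
  by apply: sumr_ge0 => S _; exact: wt_ge0.
have /choice[lim limP] (T : {set V}) : exists l, forall d, 0 < d ->
    F [set x | `|x (1%g *G T) - l| < d].
  apply: (ultra_cvg (w := fun x : X => x (1%g *G T)) UF).
  by apply: filterS FK => x Kx; exact: wt01.
have near_lim d : 0 < d -> F [set x | K x /\ forall T, `|x (1%g *G T) - lim T| < d].
  move=> d0; apply: (filterI FK).
  by apply: (filter_forall (f := fun T x => `|x (1%g *G T) - lim T| < d)) => T; exact: limP.
have lim_ge0 T : 0 <= lim T.
  rewrite leNgt; apply/negP => l0.
  rewrite -oppr_gt0 in l0; have [x [Kx /(_ T)]] := filter_ex (near_lim _ l0).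
  apply/negP; rewrite -leNgt; apply: le_trans (ler_norm _).
  by rewrite addrC lerDl wt_ge0.
have lim_neq0 x T : `|x (1%g *G T) - lim T| < lim T -> x (1%g *G T) != 0.
  by apply: contraTneq => ->; rewrite sub0r normrN ger0_norm// ltxx.
(* At most one term, since cosets determine T: the extension of [lim] by 0 to all subsets. *)
pose w A : R := \sum_(T : {set V} | `[< A = 1%g *G T >]) lim T.
have wE T : w (1%g *G T) = lim T.
  rewrite /w (big_pred1 T)// => S; apply/asboolP/eqP => [|->//].
  by move=> /(gp_coset_inj e_irr G_nontrivial).
have w_neq0 A : w A != 0 -> exists2 T, A = 1%g *G T & 0 < lim T.
  move=> /eqP/psumr_neq0P[//|T /andP[/asboolP -> lT]]; by exists T.
have lim_complete T : 0 < lim T -> is_complete e T.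
  move=> /near_lim/filter_ex[x [Kx /(_ T)/lim_neq0/wt_coset]].
  exact: complete_gp_coset.
have w_ge0 A : 0 <= w A by apply: sumr_ge0.
have w_coset A : w A != 0 -> complete_coset A.
  by move=> /w_neq0[T -> /lim_complete cT]; exists 1%g, T.
have w_chain A B : w A != 0 -> w B != 0 -> A `<=` B \/ B `<=` A.
  move=> /w_neq0[S -> S0] /w_neq0[T -> T0].
  have [x [[_ /(_ S)/lim_neq0 xS] [_ /(_ T)/lim_neq0 xT]]] :=
    filter_ex (filterI (near_lim _ S0) (near_lim _ T0)).
  exact: (wt_chain xS xT).
have w_finite : finite_set [set A | w A != 0].
  apply: (sub_finite_set (B := range (fun T : {set V} => 1%g *G T))).
    by move=> A /w_neq0[T -> _]; exists T.
  exact/finite_image/finite_finset.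
have lim_sum : \sum_(T : {set V}) lim T = 1.
  apply/eqP; rewrite -subr_eq0 -normr_le0; apply/ler_addgt0Pl => d d0.
  rewrite addr0; pose N := #|{set V}|.
  have dN : 0 < d / N.+1%:R by rewrite divr_gt0.
  have [x [Kx xd]] := filter_ex (near_lim _ dN).
  rewrite -(fundamental_sum Kx) -sumrB; apply: (le_trans (ler_norm_sum _ _ _)).
  apply: (@le_trans _ _ (\sum_(T : {set V}) d / N.+1%:R)).
    by apply: ler_sum => T _; rewrite distrC; exact: ltW.
  rewrite sumr_const -/N -[X in X <= _]mulr_natr mulrAC ler_pdivrMr//.
  by rewrite ler_wpM2l// ?ltW// ltr_nat.
have w_sum : \sum_(A \in [set: set GL]) w A = 1.
  rewrite -lim_sum (fsbigE [seq 1%g *G T | T : {set V} <- index_enum {set V}]).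
  - by rewrite big_map; apply: eq_big => T; rewrite ?in_setT.
  - rewrite map_inj_uniq ?index_enum_uniq// => S T.
    exact: gp_coset_inj.
  - by [].
  by move=> A _; apply: contraNeq => /w_neq0[T -> _]; apply: map_f; exact: mem_index_enum.
pose y : X := Complex w_ge0 w_coset w_chain w_finite w_sum.
have Ky : K y by move=> A /w_neq0[T -> /lim_complete cT]; exists T.
exists y; split=> // U /nbhs_ballP[r /= r0 rU]; apply: (filterS rU).
pose N := (#|{set V}| * #|V|)%N.
have supp : F [set x | forall T, lim T != 0 -> x (1%g *G T) != 0].
  apply: (filter_forall (f := fun T x => lim T != 0 -> x (1%g *G T) != 0)) => T.
  have [lT|lT] := eqVneq (lim T) 0; first by apply: filterS FK => x _.
  have lT0 : 0 < lim T by rewrite lt_neqAle eq_sym lT lim_ge0.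
  by apply: filterS (near_lim _ lT0) => x [_ /(_ T)/lim_neq0].
(* The successor keeps the divisor positive, also for empty V, and makes the final bound N r / (N +
   1) strictly less than r. *)
have d0 : 0 < r / N.+1%:R by rewrite divr_gt0.
apply: filterS (filterI supp (near_lim _ d0)) => x [xy [Kx xd]].
have [|||l yxl lN] := @fundamental_dist x y (r / N.+1%:R) Kx _ Ky.
- by move=> T; rewrite /= wE; exact: xy.
- exact: ltW.
- by move=> T; rewrite /= wE; exact/ltW/xd.
apply/complex_ballP; exists l => //; apply: (le_lt_trans lN).
rewrite -mulrnA -/N -[X in X < _]mulr_natr mulrAC ltr_pdivrMr//.
by rewrite ltr_pM2l// ltr_nat.
Qed.

End Complex.

(** * The action on the complex *)

Section VertexPoint.
Import Order.TTheory GRing.Theory Num.Theory.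
Variables (R : realType) (V : finType) (e : rel V) (G : V -> finGroupType).
Local Notation GL := (graph_product e G).
Local Open Scope ring_scope.
Variable B : set GL.
Hypothesis cB : complete_coset B.

Let wt A : R := (`[< A = B >])%:R.

Let wtP A : wt A != 0 -> A = B.
Proof. by rewrite /wt; case: asboolP; rewrite ?eqxx. Qed.

Let vwt_ge0 A : 0 <= wt A. Proof. by rewrite ler0n. Qed.

Let vwt_coset A : wt A != 0 -> complete_coset A.
Proof. by move=> /wtP ->. Qed.

Let vwt_chain A C : wt A != 0 -> wt C != 0 -> A `<=` C \/ C `<=` A.
Proof. by move=> /wtP -> /wtP ->; left. Qed.

Let vwt_finite : finite_set [set A | wt A != 0].
Proof. by apply: (sub_finite_set (B := [set B])) => // A /wtP. Qed.

Let vwt_sum : \sum_(A \in [set: set GL]) wt A = 1.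
Proof.
rewrite (fsbigE [:: B])//.
  by rewrite big_cons big_nil in_setT /wt asboolT//; exact: addr0.
by move=> A _; rewrite inE; apply: contraNeq => /wtP ->.
Qed.

(** Applied to the cosets of the trivial subgroup, it recovers the action on group elements from the
    action on points. *)
Definition vertex_point : complex R e G :=
  Complex vwt_ge0 vwt_coset vwt_chain vwt_finite vwt_sum.

Lemma vertex_pointE A : vertex_point A = (`[< A = B >])%:R.
Proof. by []. Qed.

End VertexPoint.

Section Action.
Import Order.TTheory GRing.Theory Num.Theory.
Variables (R : realType) (V : finType) (e : rel V) (G : V -> finGroupType).
Variable gen : forall v, G v.
Hypotheses (e_sym : symmetric e) (e_irr : irreflexive e).
Hypothesis G_abelian : forall v (a b : G v), commute a b.
Hypothesis G_nontrivial : forall v, (1 < #|G v|)%N.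
Hypothesis G_cyclic : forall v, <[gen v]> = [set: G v]%SET.
Hypothesis no_SIL : ~ has_SIL e.
Local Notation GG := (graph_product e G).
Local Notation TT := (tproduct e G).
Local Notation tG := (tgroup e G).
Local Notation X := (complex R (tedge e) tG).
Local Notation H := (Aut_pc_Sigma e gen).
Local Notation alpha := (coset_act gen e_sym G_abelian).
Local Notation phi := (phi e_sym G_abelian).
Local Notation "g *G T" := (left_coset g (gp_sub (tedge e) tG T))
  (at level 40, format "g  *G  T").

Let tG_abelian (p : tvertex e) (a b : tG p) : commute a b.
Proof. exact: G_abelian. Qed.

Let tG_nontrivial (p : tvertex e) : (1 < #|tG p|)%N.
Proof. exact: G_nontrivial. Qed.

Let tirr : irreflexive (tedge e) := @tedge_irr V e.

Let actK (a : group_aut GG) (Ha : H a) := coset_actK e_sym e_irr G_abelian G_nontrivial G_cyclic no_SIL Ha.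
Let actVK (a : group_aut GG) (Ha : H a) := coset_actVK e_sym e_irr G_abelian G_nontrivial G_cyclic no_SIL Ha.

Let sH : is_subgroup H := Aut_pc_Sigma_is_subgroup e gen.

Lemma complex_act_subproof (a : group_aut GG) (x : X) : exists y : X,
  H a -> forall A, y A = x (alpha a @^-1` A).
Proof.
have [Ha|nHa] := pselect (H a); last by exists x.
have [S [tS aS]] := coset_act_left_coset e_sym e_irr G_abelian G_nontrivial G_cyclic no_SIL Ha.
by exists (transport (actK Ha) (actVK Ha) tS aS x).
Qed.

(** An action is a total function on automorphisms; outside H the identity is the default. *)
Definition complex_act (a : group_aut GG) (x : X) : X :=
  if pselect (H a) then projT1 (cid (complex_act_subproof a x)) else x.

Lemma complex_actE a x : H a -> forall A, complex_act a x A = x (alpha a @^-1` A).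
Proof.
move=> Ha A; rewrite /complex_act; case: pselect => Ha' //=.
exact: (projT2 (cid (complex_act_subproof a x)) Ha A).
Qed.

Lemma complex_act1 x : complex_act 1 x = x.
Proof.
apply: complexP => A; rewrite complex_actE; last exact: sH.1.
by congr (wt x); apply/funext => g; rewrite /preimage /mkset coset_act1//.
Qed.

Lemma complex_actM a b x : H a -> H b ->
  complex_act (a * b) x = complex_act a (complex_act b x).
Proof.
move=> Ha Hb; apply: complexP => A.
rewrite !complex_actE//; last exact: (is_subgroupM sH).
by congr (wt x); apply/funext => g; rewrite /preimage /mkset coset_actM//.
Qed.

Lemma complex_act_group : is_group_action H complex_act.
Proof. by split=> [x|a b Ha Hb x]; [exact: complex_act1|exact: complex_actM]. Qed.

Lemma complex_act_phi g x A : complex_act (phi g) x (left_coset g A) = x A.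
Proof.
rewrite complex_actE; last exact: Aut_pc_Sigma_phi.
congr (wt x); apply/funext => h; apply/propext; rewrite /preimage /mkset.
by rewrite coset_act_phi// left_cosetE mulKg.
Qed.

Lemma complex_act_isometric : isometric_action H complex_act.
Proof.
have le a x y : H a ->
    (complex_dist (complex_act a x) (complex_act a y) <= complex_dist x y)%E.
  move=> Ha; have [S [tS aS]] := coset_act_left_coset e_sym e_irr G_abelian G_nontrivial G_cyclic no_SIL Ha.
  apply: (transport_complex_dist (actK Ha) (actVK Ha) tS aS) => z A.
  exact: complex_actE.
move=> a Ha x y; apply/eqP; rewrite eq_le le//=.
have aK z : complex_act a^-1 (complex_act a z) = z.
  rewrite -complex_actM//; last exact: (is_subgroupV sH).
  by rewrite mulVg complex_act1.
rewrite -{1}(aK x) -{1}(aK y); apply: le; exact: (is_subgroupV sH).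
Qed.

(** With radius [mass h x], every point of the ball gives weight to a coset through h. If y and its
    image under [a] both lie in the ball, the chain condition at y compares such a coset with the
    pullback of another, so h shares a clique coset with its image under [a] or under [a^-1]. Stars
    are finite, and so is the set of [a] with a prescribed image. *)
Lemma complex_act_proper : proper_action H complex_act.
Proof.
move=> x; have [h hx] := mass_gt0_ex x.
exists (mass h x) => //.
have near_mass y : ball x (mass h x) y -> (0 < mass h y)%R.
  move=> /(mass_ball tirr tG_abelian tG_nontrivial h).
  by rewrite -ltrBlDr subrr.
apply: (sub_finite_set (B := \bigcup_(h' in star h)
   ([set a | H a /\ alpha a h = h'] `|` [set a | H a /\ alpha a h' = h]))).
  move=> a [Ha [_ [[y yB <-] zB]]].
  have [T cT yT] := mass_gt0 tirr tG_nontrivial (near_mass _ yB).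
  have [S cS zS] := mass_gt0 tirr tG_nontrivial (near_mass _ zB).
  rewrite complex_actE// in zS.
  have [TS|ST] := wt_chain yT zS.
    exists (alpha a h); last by left.
    by exists S => //; exact: (TS h (gp_coset_refl _ _)).
  exists (alpha a^-1 h); last by right; split=> //; rewrite (actVK Ha).
  exists T => //; apply: ST; rewrite /preimage /mkset (actVK Ha).
  exact: gp_coset_refl.
apply: bigcup_finite => [|h' _].
  exact: (finite_star tirr tG_abelian).
by rewrite finite_setU; split; exact: finite_coset_act.
Qed.

Lemma complex_act_cocompact : cocompact_action H complex_act.
Proof.
exists (fundamental_domain (R := R) (e := tedge e) (G := tG)).
  exact: (compact_fundamental_domain tirr tG_nontrivial).
(* Translating by the inverse of an element common to the whole support turns each coset in it into
   a subgroup G_T. *)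
move=> x; have [g gx] := wt_common x.
exists (phi g), (complex_act (phi g^-1) x); split.
- exact: Aut_pc_Sigma_phi.
- move=> A; rewrite complex_actE; last exact: Aut_pc_Sigma_phi.
  move=> xA; have := gx _ xA.
  have [T cT AE] := complete_coset_in (wt_coset xA) (gx _ xA).
  move=> _; exists T => //; rewrite left_coset1; apply/seteqP; split=> h.
    move=> Ah; have : (alpha (phi g^-1) @^-1` A) (g * h).
      by rewrite /preimage /mkset coset_act_phi// mulKg.
    by rewrite AE left_cosetE mulKg.
  move=> Th; have : (g *G T) (g * h) by exists h.
  by rewrite -AE /preimage /mkset coset_act_phi// mulKg.
- rewrite -complex_actM; try exact: Aut_pc_Sigma_phi.
  by rewrite -(phiM e_sym G_abelian no_SIL) mulgV (gmorph1 (phiM e_sym G_abelian no_SIL)) complex_act1.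
Qed.

Lemma complex_act_faithful :
  (forall v, cone_vertex e v -> #|G v| = 2 /\ forall w, cone_vertex e w -> w = v) ->
  faithful_action H complex_act.
Proof.
move=> coneP a Ha aid.
apply: (coset_act_faithful e_irr G_nontrivial G_cyclic no_SIL coneP Ha) => g.
have c0 : complete_coset (g *G finset.set0).
  by exists g, finset.set0; split=> //; apply/forall_inP => v; rewrite inE.
have := complex_actE (vertex_point R c0) Ha (alpha a @` (g *G finset.set0)).
rewrite aid (preimage_imageK (actK Ha)) !vertex_pointE.
rewrite (asboolT (erefl (g *G finset.set0))).
case: asboolP => [E _|_ /eqP]; last by rewrite eq_sym oner_eq0.
have : (g *G finset.set0) (alpha a g).
  by rewrite -E; exists g => //; exact: gp_coset_refl.
rewrite left_cosetE => /(gp_sub_min (H := [set 1%g])) h.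
apply: (mulgI g^-1); rewrite mulVg; apply: h => [|p b]; last by rewrite inE.
by split=> // _ _ -> ->; rewrite /= invg1 mulg1.
Qed.

End Action.

Theorem corollary4p2 (R : realType) (V : finType) (e : rel V)
    (G : V -> finGroupType) (gen : forall v, G v)
    (e_sym : symmetric e) (e_irr : irreflexive e)
    (G_nontrivial : forall v, (1 < #|G v|)%N)
    (G_cyclic : forall v, <[gen v]> = [set: G v]%SET)
    (no_SIL : ~ has_SIL e) :
  let GG := graph_product e G in
  let X := complex R (tedge e) (tgroup e G) in
  let H := Aut_pc_Sigma e gen in
  exists (phi : {multiplicative tproduct e G -> group_aut GG})
         (act : group_aut GG -> X -> X),
    [/\ injective phi,
        range phi = Aut_pc e gen &
        forall p : tvertex e,
          is_partial_conj gen (tbase p) (tcomp p) (phi (tgen e gen p))] /\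
    internal_sdprod (Aut_pc e gen) (Sigma e gen) H /\
    is_group_action H act /\
    (forall (g : tproduct e G) (x : X) (A : set (tproduct e G)),
       act (phi g) x (left_coset g A) = x A) /\
    geometric_action H act /\
    ((forall v, cone_vertex e v ->
        #|G v| = 2 /\ forall w, cone_vertex e w -> w = v) ->
     faithful_action H act).
Proof.
have G_abelian v (a b : G v) : commute a b.
  have [m ->] := genP G_cyclic a; have [n ->] := genP G_cyclic b.
  exact/commuteX2/commute_refl.
move=> GG X H.
pose f : {multiplicative tproduct e G -> group_aut GG} :=
  HB.pack (phi e_sym G_abelian)
    (isMultiplicative.Build _ _ (phi e_sym G_abelian) (phiM e_sym G_abelian no_SIL)).
exists f, (complex_act e_sym e_irr G_abelian G_nontrivial G_cyclic no_SIL).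
split; first split.
- exact: (phi_inj e_irr G_nontrivial no_SIL).
- exact: range_phi.
- exact: phi_tgen.
split; first exact: Aut_pc_Sigma_sdprod.
split; first exact: complex_act_group.
split; first exact: complex_act_phi.
split; last exact: complex_act_faithful.
split; [exact: complex_act_proper|exact: complex_act_cocompact|].
exact: complex_act_isometric.
Qed.
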